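(* Let $F$ be any probability distribution on $[0,\infty)$, and consider first-passage percolation on $\mathbb{Z}^2$ with i.i.d. edge weights distributed according to $F$. For $q\in(0,1)$ let $t_q:=\inf\{t\ge 0: F(t)\ge q\}$, where $F(t)$ denotes the distribution function of $F$. Then the time constant $\mu$ satisfies $$\tfrac{1}{100}\,t_{1/3}\;\le\;\mu\;\le\;2\,t_{2/3}.$$
   Context: First-passage percolation on the square lattice $\mathbb{Z}^2$ (with nearest-neighbour edges): weights $\omega_e$ are assigned independently to the edges $e$, each with distribution $F$ on $[0,\infty)$. For $x,y\in\mathbb{Z}^2$ define $T(x,y):=\inf\{\sum_{e\in\pi}\omega_e : \pi \text{ is a self-avoiding path connecting } x \text{ to } y\}$. The time constant $\mu$ is the limit $\mu:=\lim_{n\to\infty}\frac1n T\big((0,0),(n,0)\big)$; this limit exists in probability (as a deterministic constant in $[0,\infty)$) for every weight distribution $F$, and almost surely when $\mathbb{E}[Y]<\infty$, where $Y$ is the minimum of four independent $F$-distributed variables. *)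

(* Defs.v *)
From HB Require Import structures.
From mathcomp Require Import all_boot all_order all_algebra.
From mathcomp Require Import all_classical all_reals all_analysis.
Set Implicit Arguments. Unset Strict Implicit. Unset Printing Implicit Defensive.
Import Order.TTheory GRing.Theory Num.Theory.
Import numFieldNormedType.Exports.
Local Open Scope classical_set_scope.
Local Open Scope ring_scope.

Definition vertex := (int * int)%type.

Definition adjZ2 : rel vertex :=
  fun u v => (`|u.1 - v.1|%N + `|u.2 - v.2|%N == 1)%N.

(* An edge of Z^2 is encoded by its lower/left endpoint and a direction:
   (z, true) is the edge {z, z + (1,0)}, (z, false) is the edge {z, z + (0,1)}.
   This is a bijection with the set of nearest-neighbour edges. *)
Definition edge := (vertex * bool)%type.

Definition edge_of (u v : vertex) : edge :=
  if u.2 == v.2 then ((Order.min u.1 v.1, u.2), true)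
  else ((u.1, Order.min u.2 v.2), false).

Definition sa_path (x y : vertex) (s : seq vertex) : bool :=
  [&& path adjZ2 x s, uniq (x :: s) & last x s == y].

Definition path_weight {R : realType} (w : edge -> R) (x : vertex) (s : seq vertex) : R :=
  \sum_(e <- pairmap edge_of x s) w e.

Definition passage_time {R : realType} (w : edge -> R) (x y : vertex) : R :=
  inf [set r : R | exists s, sa_path x y s /\ r = path_weight w x s].

Definition mutually_independent {d} {Omega : measurableType d} {R : realType}
  {I : eqType} (P : probability Omega R) (X : I -> Omega -> R) : Prop :=
  forall (s : seq I) (B : I -> set R),
    uniq s -> (forall i, measurable (B i)) ->
    P (\bigcap_(i in [set` s]) (X i @^-1` B i)) = (\prod_(i <- s) P (X i @^-1` B i))%E.

Definition cdf {R : realType} (F : probability R R) (t : R) : \bar R :=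
  F [set x : R | x <= t].

Definition quantile {R : realType} (F : probability R R) (q : R) : R :=
  inf [set t : R | 0 <= t /\ (q%:E <= cdf F t)%E].

Definition cvg_in_prob {d} {Omega : measurableType d} {R : realType}
  (P : probability Omega R) (Y : nat -> Omega -> R) (c : R) : Prop :=
  forall eps : R, 0 < eps ->
    (fun n => P [set om | eps < `|Y n om - c|]) @ \oo --> 0%E.

(* Main.v *)
Require Import Defs.
From HB Require Import structures.
From mathcomp Require Import all_boot all_order all_algebra.
From mathcomp Require Import all_classical all_reals all_analysis.
From mathcomp Require Import measurable_realfun.
From mathcomp Require Import zify ring lra.
Set Implicit Arguments. Unset Strict Implicit. Unset Printing Implicit Defensive.
Import Order.TTheory GRing.Theory Num.Theory.
Import numFieldNormedType.Exports.
Local Open Scope ring_scope.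

(* Upper bound.  Among the edges of weight at most t, which are open with
   probability at least 2/3, up-right paths survive with probability at least 1/2
   (Liggett's bound for oriented percolation).  Let h(A) be the probability that
   the Holley-Liggett renewal process hits A.  Extend h to staircases, where part
   of the line has already been updated, by a suitable two-point function across
   the kink; then each single-vertex update has nonnegative drift (zero drift when
   the vertex is occupied), so E h(A_n) >= h({0}) = 1/2.  By reflection in the
   diagonal, Harris' inequality, and taking maxima of paths, with probability
   bounded below there is such a path from (0, 0) staying below the diagonal up to
   an error m, and its mirror image from (n, 0).  They cross at a height at most
   n/2 + 2m, so the passage time is at most (2n + 4m) t.

   Lower bound.  Edges of weight at most t < t_{1/3} have probability at most 1/3.
   Self-avoiding walks of length 10k + 1 number at most 4 * 30073^k, and 30073^(1/10)
   is small enough for a union bound: with high probability every such walk has at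
   least a hundredth of its edges heavier than t. *)

(** * Hitting probabilities of the renewal process *)

Section RenewalCapacity.
Variable R : realFieldType.
Implicit Types (os ns : seq bool) (f g : nat -> R).

Fixpoint catalan_prefix n : seq R :=
  if n is m.+1 then
    let l := catalan_prefix m in rcons l (\sum_(i < m.+1) l`_i * l`_(m - i))
  else [:: 1/4].

(* [catalan_mass n] is [Cat_n / 4 ^ n.+1], with generating function
   [1 / (2 (1 + w))] in terms of [w = sqrt (1 - z)]. *)
Definition catalan_mass n : R := (catalan_prefix n)`_n.
Arguments catalan_mass n%_N : simpl never.
Local Notation D := catalan_mass.

Lemma size_catalan_prefix n : size (catalan_prefix n) = n.+1.
Proof. by elim: n => //= n IH; rewrite size_rcons IH. Qed.

Lemma nth_catalan_prefix n i : (i <= n)%N -> (catalan_prefix n)`_i = D i.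
Proof.
elim: n => [|n IH]; first by rewrite leqn0 => /eqP ->.
rewrite leq_eqVlt => /orP [/eqP -> //|lin].
by rewrite /= nth_rcons size_catalan_prefix lin IH.
Qed.

Lemma catalan_mass0 : D 0 = 1/4. Proof. by []. Qed.

Lemma catalan_massS n : D n.+1 = \sum_(i < n.+1) D i * D (n - i).
Proof.
rewrite {1}/catalan_mass /= nth_rcons size_catalan_prefix ltnn eqxx.
by apply: eq_bigr => i _; rewrite !nth_catalan_prefix ?leq_subr // -ltnS.
Qed.

Lemma catalan_mass_ge0 n : 0 <= D n.
Proof.
have [m] := ubnP n; elim: m n => // m IH [_|n]; first by rewrite catalan_mass0; lra.
rewrite ltnS => lnm; rewrite catalan_massS; apply: sumr_ge0 => i _.
by apply: mulr_ge0; apply: IH; [apply: leq_trans lnm|apply: leq_ltn_trans lnm; apply: leq_subr].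
Qed.

(** Partial sums satisfy [s_(n+1) <= 1/4 + s_n ^ 2], because the triangle of index pairs in the
    convolution lies in a square; this recursion cannot pass its fixed point 1/2. *)
Lemma sum_catalan_mass_le n : \sum_(i < n) D i <= 1/2.
Proof.
elim: n => [|n IH]; first by rewrite big_ord0; lra.
rewrite big_ord_recl catalan_mass0.
have pos k : 0 <= \sum_(i < k) D i by apply: sumr_ge0 => i _; apply: catalan_mass_ge0.
suff : \sum_(i < n) D (bump 0 i) <= (\sum_(i < n) D i) * (\sum_(i < n) D i).
  by have := pos n; move: IH; set a := \sum_(i < n) D i; set b := \sum_(i < n) _; nra.
under eq_bigr => i _ do rewrite /bump /= add1n catalan_massS.
rewrite mulr_suml.
under [X in _ <= X]eq_bigr => i _ do rewrite mulr_sumr.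
have split_diag (i : 'I_n) : \sum_(j < i.+1) D j * D (i - j)
    = \sum_(j < n | (j <= i)%N) D j * D (i - j).
  rewrite -(big_mkord xpredT (fun j => D j * D (i - j))).
  by rewrite (big_nat_widen _ _ n) //=
    -(big_mkord (fun j => (j < i.+1)%N) (fun j => D j * D (i - j))).
under eq_bigr => i _ do rewrite split_diag.
rewrite (exchange_big_dep xpredT) //=; apply: ler_sum => j _.
have -> : \sum_(i < n | (j <= i)%N) D j * D (i - j) = \sum_(0 <= i < n - j) D j * D i.
  rewrite -(big_mkord (fun i => (j <= i)%N) (fun i => D j * D (i - j))).
  rewrite (@big_cat_nat _ _ _ j) //=; last by apply: ltnW.
  rewrite big_nat_cond big_pred0 ?add0r; last first.
    by move=> i; case: (ltnP i j) => //=; rewrite andbF.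
  rewrite -{1}[nat_of_ord j]add0n big_addn big_nat_cond [RHS]big_nat_cond.
  apply: eq_big => [i|i _]; first by rewrite leq_addl.
  by rewrite addnK.
rewrite -(big_mkord xpredT (fun i => D j * D i)).
rewrite [X in _ <= X](@big_cat_nat _ _ _ (n - j)) //=; last exact: leq_subr.
by rewrite lerDl; apply: sumr_ge0 => i _; apply: mulr_ge0; apply: catalan_mass_ge0.
Qed.

(* Probability that a particle sits at distance n from a given one, for the
   Holley-Liggett renewal process on Z; its density is 1/2, the limit of
   [renewal_mass], and its gap law has mass 3/4 at 1. *)
Definition renewal_mass n : R := 1 - \sum_(i < n) D i.
Arguments renewal_mass n%_N : simpl never.
Local Notation u := renewal_mass.

Lemma renewal_mass0 : u 0 = 1.
Proof. by rewrite /u big_ord0 subr0. Qed.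

Lemma renewal_massS n : u n.+1 = u n - D n.
Proof. by rewrite /u big_ord_recr /= opprD addrA. Qed.

Lemma renewal_mass_ge n : 1/2 <= u n.
Proof. by rewrite /u; have := sum_catalan_mass_le n; lra. Qed.

Lemma renewal_mass_le1 n : u n <= 1.
Proof.
rewrite /u lerBlDr lerDl; apply: sumr_ge0 => i _; exact: catalan_mass_ge0.
Qed.

Lemma renewal_mass_anti n : u n.+1 <= u n.
Proof. by rewrite renewal_massS; have := catalan_mass_ge0 n; lra. Qed.

(* The generating function is [1 / (2 (1 + w) (2 + w))], [w = sqrt (1 - z)]. *)
Fixpoint kink_mass n : R :=
  if n is m.+1 then D m.+1 - kink_mass m / 3 else 1/12.
Arguments kink_mass n%_N.
Local Notation delta := kink_mass.

(** Coefficient form of [z delta(z) D(z) = 3/2 delta(z) - 1/2 D(z)]. It yields a recursion for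
    [delta] without subtraction, hence positivity, and collapses the sums in the first two columns
    of [kink_kernel]. *)
Lemma kink_mass_conv n :
  \sum_(m < n.+1) delta m * D (n - m) = 3/2 * delta n.+1 - 1/2 * D n.+1.
Proof.
elim: n => [|n IH].
  have D1 : D 1 = 1/4 * (1/4) by rewrite catalan_massS big_ord1.
  by rewrite big_ord1 subn0 /= D1 catalan_mass0; lra.
have shift_sum : \sum_(m < n.+1) delta m.+1 * D (n - m)
    = D n.+2 - 1/4 * D n.+1 - 1/3 * \sum_(m < n.+1) delta m * D (n - m).
  rewrite (catalan_massS n.+1) (big_ord_recl n.+1) -[nat_of_ord ord0]/0%N subn0.
  rewrite catalan_mass0 mulr_sumr.
  rewrite [1/4 * _ + _]addrC addrK -sumrB; apply: eq_bigr => i _.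
  by rewrite lift0 subSS /=; ring.
rewrite big_ord_recl subn0 [delta 0]/=.
under eq_bigr => i _ do rewrite lift0 subSS.
rewrite shift_sum IH /=; lra.
Qed.

Lemma kink_mass_ge0 n : 0 <= delta n.
Proof.
have [m] := ubnP n; elim: m n => // m IH [_|n]; first by rewrite /=; lra.
rewrite ltnS => lnm.
have : 0 <= \sum_(m < n.+1) delta m * D (n - m).
  apply: sumr_ge0 => i _; apply: mulr_ge0; last exact: catalan_mass_ge0.
  by apply: IH; apply: leq_trans lnm.
by rewrite kink_mass_conv; have := catalan_mass_ge0 n.+1; lra.
Qed.

(* When the sites to the right of a kink have already been updated,
   [kink_kernel i j] replaces [renewal_mass (i + j).+1] as the conditional
   probability of a particle at the j-th updated site given one at the i-th old
   site, both counted from the kink.  It is the kernel for which updating an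
   occupied vertex with q = 2/3 leaves hitting probabilities unchanged. *)
Fixpoint kink_kernel i j : R :=
  if i is k.+1 then kink_kernel k j.+1 + 2/3 * delta k * D j
  else 2/3 * u j.+1 + 1/3 * u j.
Arguments kink_kernel i%_N j%_N.
Local Notation W := kink_kernel.

Lemma kink_kernel_sum i j :
  W i j = 2/3 * u (i + j).+1 + 1/3 * u (i + j)
          + 2/3 * \sum_(m < i) delta m * D (i.-1 - m + j).
Proof.
elim: i j => [|i IH] j; first by rewrite big_ord0 /= add0n; lra.
have shift : \sum_(m < i) delta m * D (i.-1 - m + j.+1) = \sum_(m < i) delta m * D (i - m + j).
  apply: eq_bigr => m _; congr (_ * D _).
  by have := ltn_ord m; case: i {IH} m => [|i] m //=; rewrite ltnS => ?; rewrite addnS subSn.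
by rewrite /= IH addnS addSn shift big_ord_recr /= subnn add0n; ring.
Qed.

Lemma kink_kernel0 i : W i 0 = u i.+1 + delta i.
Proof.
rewrite kink_kernel_sum addn0; case: i => [|i].
  by rewrite big_ord0 renewal_massS catalan_mass0 /=; lra.
under eq_bigr => m _ do rewrite addn0.
by rewrite /= kink_mass_conv (renewal_massS i.+1) /=; lra.
Qed.

Lemma kink_kernel1 i : W i 1 = u i.+1 - delta i / 2.
Proof.
have := kink_kernel_sum i 1; rewrite addn1.
have -> : \sum_(m < i) delta m * D (i.-1 - m + 1)
    = \sum_(m < i.+1) delta m * D (i - m) - 1/4 * delta i.
  rewrite big_ord_recr /= subnn catalan_mass0 mulrC addrK; apply: eq_bigr => m _.
  congr (_ * D _); have := ltn_ord m; case: i m => [|i] m //=.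
  by rewrite ltnS => ?; rewrite addn1 subSn.
rewrite kink_mass_conv => ->; rewrite (renewal_massS i.+1) /=; lra.
Qed.

(* A finite set of sites is a list of booleans read away from a base site.
   [escape s] is the probability that the renewal process misses s, given a
   particle at the base site, and decomposing over the farthest hit shows that
   [escape_sum s (fun=> 1)] is twice the probability that s is hit. *)
Fixpoint escape_sum s f : R :=
  if s is b :: s' then
    (if b then (1 - escape_sum s' (u \o succn)) * f 0%N else 0)
    + escape_sum s' (f \o succn)
  else 0.
Local Notation S := escape_sum.

Definition escape s : R := 1 - S s (u \o succn).

Lemma eq_escape_sum s f g : f =1 g -> S s f = S s g.
Proof.
elim: s f g => //= b s IH f g fg; rewrite fg; congr (_ + _).
by apply: IH => i; apply: fg.
Qed.

Lemma escape_sumZD s a f c g :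
  S s (fun i => a * f i + c * g i) = a * S s f + c * S s g.
Proof.
elim: s f g => [|b s IH] f g /=; first by lra.
have -> : S s ((fun i => a * f i + c * g i) \o succn)
    = a * S s (f \o succn) + c * S s (g \o succn) by exact: IH.
by case: b; ring.
Qed.

Lemma escape_consE b s f :
  S (b :: s) f = (if b then escape s * f 0%N else 0) + S s (f \o succn).
Proof. by []. Qed.

(** Monotonicity needs nonnegative escape probabilities, whose proof uses monotonicity on shorter
    lists; the hypothesis on suffixes breaks this circle. *)
Lemma escape_sum_mono_of s f g :
  (forall i, 0 <= escape (drop i s)) -> (forall i, f i <= g i) -> S s f <= S s g.
Proof.
elim: s f g => // b s IH f g pos fg; rewrite !escape_consE; apply: lerD.
  case: b {pos} (pos 1%N) => //=; rewrite drop0 => pos1.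
  exact: ler_wpM2l.
by apply: IH => i; [apply: (pos i.+1)|apply: fg].
Qed.

(** As [u] decreases, a vacant head does not lower [escape]. With an occupied head, [u 1 <= 1] also
    bounds the result below by [1 - escape s - S s (u \o succn) = 0]. *)
Lemma escape_ge0 s : 0 <= escape s.
Proof.
have [n] := ubnP (size s); elim: n s => // n IH [|b s] szs.
  by rewrite /escape /=; lra.
have pos i : 0 <= escape (drop i s).
  by apply: IH; rewrite size_drop (leq_ltn_trans (leq_subr _ _)).
have step : S s ((u \o succn) \o succn) <= S s (u \o succn).
  by apply: escape_sum_mono_of => // i; apply: renewal_mass_anti.
rewrite /escape escape_consE; move: (pos 0%N); rewrite drop0.
case: b {szs} => [pos0|]; last by rewrite add0r; move: step; rewrite /escape; lra.
have u1 : escape s * (u \o succn) 0%N <= escape s.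
  by apply: ler_piMr => //=; apply: renewal_mass_le1.
have escE : escape s = 1 - S s (u \o succn) by [].
by move: step u1; rewrite -/(S s _) {2}escE; lra.
Qed.

Lemma escape_sum_mono s f g : (forall i, f i <= g i) -> S s f <= S s g.
Proof. by apply: escape_sum_mono_of => i; apply: escape_ge0. Qed.

(** Since [1 <= 2 * u], the sum is at most [2 * (1 - escape s)]. *)
Lemma escape_sum_le2 s : S s (fun=> 1) <= 2.
Proof.
have half_le : S s (fun=> 1) <= S s (fun i => 2 * (u \o succn) i + 0 * 0).
  by apply: escape_sum_mono => i /=; have := renewal_mass_ge i.+1; lra.
have := escape_sumZD s 2 (u \o succn) 0 (fun=> 0) => E.
by move: half_le; rewrite E; have := escape_ge0 s; rewrite /escape; lra.
Qed.

Lemma escape_sum_nil s f : ~~ has id s -> S s f = 0.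
Proof. by elim: s f => //= -[] s IH f //= /IH ->; rewrite add0r. Qed.

(** Conditional probability of missing [os], given a particle at the j-th site on the other side of
    a cut; both sides are read away from the cut. *)
Definition flat_cross os j := 1 - S os (fun i => u (i + j).+1).

Definition flat_capacity os ns := S os (fun=> 1) + S ns (flat_cross os).

Lemma flat_capacity_shift o os ns : flat_capacity (o :: os) ns = flat_capacity os (o :: ns).
Proof.
rewrite /flat_capacity !escape_consE -addrA addrCA; congr (_ + _).
have -> : S ns (flat_cross os \o succn)
    = S ns (flat_cross (o :: os)) + (if o then escape os * S ns (u \o succn) else 0).
  have -> : (if o then escape os * S ns (u \o succn) else 0)
      = (if o then escape os else 0) * S ns (u \o succn) by case: o; rewrite ?mul0r.
  rewrite -[X in X + _]mul1r -escape_sumZD; apply: eq_escape_sum => j.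
  rewrite /comp /flat_cross escape_consE add0n.
  rewrite (@eq_escape_sum os _ (fun i => u (i + j.+1).+1)); last by move=> i /=; rewrite addSnnS.
  by case: o => /=; ring.
case: o; last by rewrite !add0r addr0.
by rewrite /flat_cross /= (@eq_escape_sum os _ (u \o succn)) => [|i];
   rewrite ?addn0 //= /escape; ring.
Qed.

(** The decomposition at a cut does not depend on where the cut is; sliding it from one end of [s]
    to the other reverses the direction of reading. *)
Lemma escape_sum_rev s : S (rev s) (fun=> 1) = S s (fun=> 1).
Proof.
have shift_all os ns : flat_capacity os ns = flat_capacity [::] (catrev os ns).
  by elim: os ns => //= o os IH ns; rewrite flat_capacity_shift IH.
have := shift_all s [::]; rewrite /flat_capacity -/(rev s) /= addr0 add0r => ->.
by apply: eq_escape_sum => j; rewrite /flat_cross /= subr0.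
Qed.

Definition kink_cross os j := 1 - S os (W ^~ j).

(* The head of [os] is the next vertex to be updated; the head of [ns] is the
   site immediately across the kink. *)
Definition kink_capacity os ns := S os (fun=> 1) + S ns (kink_cross os).

Lemma kink_cross_true os j :
  kink_cross (true :: os) j = kink_cross os j.+1 - escape os * W 0 j
    - 2/3 * D j * S os delta.
Proof.
rewrite /kink_cross escape_consE.
rewrite (@eq_escape_sum os _ (fun i => 1 * W i j.+1 + (2/3 * D j) * delta i)) => [|i /=];
  last by ring.
rewrite escape_sumZD; ring.
Qed.

Lemma kink_cross_false os j : kink_cross (false :: os) j <= kink_cross os j.+1.
Proof.
rewrite /kink_cross escape_consE add0r lerD2l lerN2; apply: escape_sum_mono => i /=.
by rewrite lerDl !mulr_ge0 ?kink_mass_ge0 ?catalan_mass_ge0 //; lra.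
Qed.

(** The source of the nonnegative drift: moving a vacant vertex across the kink drops the term
    [2/3 * delta k * D j >= 0] from the kernel. *)
Lemma kink_capacity_false os ns :
  kink_capacity (false :: os) ns <= kink_capacity os (false :: ns).
Proof.
rewrite /kink_capacity !escape_consE !add0r lerD2l.
by apply: escape_sum_mono => j; apply: kink_cross_false.
Qed.

(** The four terms are the states of the two outgoing edges. Columns 0 and 1 of the kernel are
    combinations of [u] and [delta], so both sides reduce to the same expression in [l], [d], [B],
    [U1] and [U2]. *)
Lemma kink_capacity_true os n ns :
  kink_capacity (true :: os) (n :: ns) =
    2/3 * (2/3 * kink_capacity os [:: true, true & ns]
           + 1/3 * kink_capacity os [:: true, n & ns])
  + 1/3 * (2/3 * kink_capacity os [:: false, true & ns]
           + 1/3 * kink_capacity os [:: false, n & ns]).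
Proof.
set l := escape os; set d := S os delta.
have cross0 : kink_cross os 0 = l - d.
  rewrite /kink_cross.
  rewrite (@eq_escape_sum os _ (fun i => 1 * (u \o succn) i + 1 * delta i)) => [|i /=]; last first.
    by rewrite kink_kernel0 /=; ring.
  by rewrite escape_sumZD /l /escape -/d; ring.
have cross1 : kink_cross os 1 = l + d / 2.
  rewrite /kink_cross (@eq_escape_sum os _
    (fun i => 1 * (u \o succn) i + (- (1/2)) * delta i)) => [|i /=]; last first.
    by rewrite kink_kernel1 /=; ring.
  by rewrite escape_sumZD /l /escape -/d; ring.
set B := S ns ((kink_cross os \o succn) \o succn).
set U1 := S ns (u \o succn); set U2 := S ns ((u \o succn) \o succn).
have tail : S ns (kink_cross (true :: os) \o succn)
    = B - 2/3 * (l - d) * U2 - (1/3 * l + 2/3 * d) * U1.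
  rewrite (@eq_escape_sum ns _ (fun j => 1 * (1 * ((kink_cross os \o succn) \o succn) j
     + (- (2/3 * (l - d))) * ((u \o succn) \o succn) j)
     + (- (1/3 * l + 2/3 * d)) * (u \o succn) j)) => [|j /=]; last first.
    by rewrite kink_cross_true -/l -/d /= (renewal_massS j.+1); ring.
  by rewrite !escape_sumZD -/B -/U1 -/U2; ring.
have head : kink_cross (true :: os) 0 = 1/6 * l + 1/3 * d.
  rewrite kink_cross_true cross1 -/l -/d /= renewal_massS renewal_mass0 catalan_mass0; lra.
have escE : escape ns = 1 - U1 by [].
rewrite /kink_capacity !escape_consE -/l tail head /= cross0 cross1 /escape /= -/U1 -/U2 -/B -/l.
rewrite -/(escape ns) escE renewal_massS renewal_mass0 catalan_mass0.
by case: n => /=; field.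
Qed.
End RenewalCapacity.

(** * Bernoulli expectations and survival *)

Section Bernoulli.
Variable R : realFieldType.
Implicit Types (p : R) (f g : seq bool -> R) (a b : seq bool).

Fixpoint bernE p n f : R :=
  if n is m.+1 then
    p * bernE p m (f \o cons true) + (1 - p) * bernE p m (f \o cons false)
  else f [::].

Lemma eq_bernE p n f g :
  (forall a, size a = n -> f a = g a) -> bernE p n f = bernE p n g.
Proof.
elim: n f g => /= [|n IH] f g fg; first exact: fg.
by congr (_ * _ + _ * _); apply: IH => a sa /=; apply: fg => /=; rewrite sa.
Qed.

Lemma le_bernE p n f g : 0 <= p <= 1 ->
  (forall a, size a = n -> f a <= g a) -> bernE p n f <= bernE p n g.
Proof.
move=> /andP[p0 p1]; elim: n f g => /= [|n IH] f g fg; first exact: fg.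
apply: lerD; apply: ler_wpM2l; rewrite ?subr_ge0 //;
  by apply: IH => a sa /=; apply: fg => /=; rewrite sa.
Qed.

Lemma bernE_ZD p n r f s g :
  bernE p n (fun a => r * f a + s * g a) = r * bernE p n f + s * bernE p n g.
Proof.
elim: n f g => // n IH f g.
by have /= -> := IH (f \o cons true) (g \o cons true);
   have /= -> := IH (f \o cons false) (g \o cons false); ring.
Qed.

Lemma bernE_cat p n m f :
  bernE p (n + m) f = bernE p n (fun a => bernE p m (fun b => f (a ++ b))).
Proof. by elim: n f => //= n IH f; rewrite !IH. Qed.

Lemma bernESS p n f : bernE p n.+2 f =
  p * (p * bernE p n (fun a => f [:: true, true & a])
       + (1 - p) * bernE p n (fun a => f [:: true, false & a]))
  + (1 - p) * (p * bernE p n (fun a => f [:: false, true & a])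
       + (1 - p) * bernE p n (fun a => f [:: false, false & a])).
Proof. by []. Qed.

Definition bits_le a b := forall i, nth false a i -> nth false b i.

Definition increasing f := forall a b, size a = size b -> bits_le a b -> f a <= f b.

Lemma increasing_cons f x : increasing f -> increasing (f \o cons x).
Proof.
by move=> incf a b sab ab; apply: incf => /=; [rewrite sab|case=> //= i; apply: ab].
Qed.

Lemma bernE_cons_le p n f : 0 <= p <= 1 -> increasing f ->
  bernE p n (f \o cons false) <= bernE p n (f \o cons true).
Proof. by move=> p01 incf; apply: le_bernE => // a _; apply: incf => // -[]. Qed.

Lemma bernE_mono p q n f : 0 <= p -> p <= q -> q <= 1 -> increasing f ->
  bernE p n f <= bernE q n f.
Proof.
move=> p0 pq q1; elim: n f => //= n IH f incf.
have p01 : 0 <= p <= 1 by rewrite p0 (le_trans pq).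
have := bernE_cons_le n p01 incf.
have := IH _ (increasing_cons true incf); have := IH _ (increasing_cons false incf).
set f1 := bernE p n _; set f2 := bernE p n _; set g1 := bernE q n _; set g2 := bernE q n _.
by move=> H1 H2 H3; nra.
Qed.

(** Induction on the bits: conditioning on the first one leaves the covariance
    [p * (1 - p) * ((f1 - f0) * (g1 - g0))], which is nonnegative. *)
Lemma harris p n f g : 0 <= p <= 1 -> increasing f -> increasing g ->
  bernE p n f * bernE p n g <= bernE p n (fun a => f a * g a).
Proof.
move=> p01; have /andP[p0 p1] := p01; elim: n f g => //= n IH f g incf incg.
have F := bernE_cons_le n p01 incf; have G := bernE_cons_le n p01 incg.
have H1 := IH _ _ (increasing_cons true incf) (increasing_cons true incg).
have H0 := IH _ _ (increasing_cons false incf) (increasing_cons false incg).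
move: F G H1 H0.
set f1 := bernE p n (f \o cons true); set f0 := bernE p n (f \o cons false).
set g1 := bernE p n (g \o cons true); set g0 := bernE p n (g \o cons false).
set h1 := bernE p n (fun a => _); set h0 := bernE p n (fun a => _) => F G H1 H0.
change (bernE p n (_ \o cons true)) with h1.
change (bernE p n (_ \o cons false)) with h0.
have K : 0 <= p * (1 - p) * ((f1 - f0) * (g1 - g0)).
  by rewrite !mulr_ge0 // subr_ge0.
have L : p * (f1 * g1) + (1 - p) * (f0 * g0) <= p * h1 + (1 - p) * h0.
  by apply: lerD; apply: ler_wpM2l; rewrite ?subr_ge0.
apply: le_trans L; rewrite -subr_ge0; apply: le_trans K _.
by rewrite le_eqVlt; apply/orP; left; apply/eqP; ring.
Qed.

End Bernoulli.

(** * Survival of oriented percolation with edge probability 2/3 *)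

Section Survival.
Variable R : realFieldType.

(* One time step of oriented percolation: the vertices of [os] are updated one
   by one, from the kink outwards, each reading two bits for its outgoing edges;
   hence the new generation is listed in the opposite order. *)
Fixpoint sweep (os ns bits : seq bool) : seq bool :=
  match os, ns, bits with
  | o :: os', n :: nt, b0 :: b1 :: bits' =>
      sweep os' [:: o && b0, n || o && b1 & nt] bits'
  | _, _, _ => ns
  end.

Lemma size_sweep os n ns bits : size bits = (2 * size os)%N ->
  size (sweep os (n :: ns) bits) = (size os + size ns).+1.
Proof.
elim: os n ns bits => [|o os IH] n ns //= [|b0 [|b1 bits]]; rewrite ?mulnS //=.
by move=> [] /IH -> /=; rewrite addnS.
Qed.

Local Notation C := (@kink_capacity R).

(** The capacity of the staircase is a submartingale under single-vertex updates; once [os] is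
    exhausted the line is straight again. *)
Lemma bernE_sweep os n ns :
  C os (n :: ns) <= bernE (2/3) (2 * size os) (fun bits => C [::] (sweep os (n :: ns) bits)).
Proof.
elim: os n ns => [|o os IH] n ns; first by rewrite muln0 /=.
rewrite [size _]/= mulnS bernESS /=.
have -> : 1 - 2/3 = 1/3 :> R by field.
case: o; last first.
  apply: (le_trans (kink_capacity_false _ _ _)).
  by have := IH false (n :: ns); rewrite /= orbF; lra.
rewrite kink_capacity_true /= orbT orbF.
have := IH true (true :: ns); have := IH true (n :: ns).
have := IH false (true :: ns); have := IH false (n :: ns).
by rewrite /=; lra.
Qed.

(** Generations are listed by increasing abscissa and swept from the largest one. The initial
    [false] is the new site one beyond the old generation, which no edge has reached yet. *)
Fixpoint run k (s bits : seq bool) : seq bool :=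
  if k is k'.+1 then
    run k' (sweep (rev s) [:: false] (take (2 * size s) bits)) (drop (2 * size s) bits)
  else s.

Fixpoint run_length k m : nat := if k is k'.+1 then (2 * m + run_length k' m.+1)%N else 0%N.

Local Notation S1 s := (@escape_sum R s (fun=> 1)).

Lemma kink_capacity_nil s : C [::] s = S1 s.
Proof.
by rewrite /kink_capacity /= add0r; apply: eq_escape_sum => j; rewrite /kink_cross /= subr0.
Qed.

Lemma bernE_run k s :
  S1 s <= bernE (2/3) (run_length k (size s)) (fun bits => S1 (run k s bits)).
Proof.
elim: k s => [|k IH] s //=.
rewrite bernE_cat -escape_sum_rev.
have -> : S1 (rev s) = C (rev s) [:: false] by rewrite /kink_capacity /= !addr0.
apply: (le_trans (bernE_sweep _ _ _)); rewrite size_rev.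
apply: le_bernE => [|a sa]; first by lra.
rewrite kink_capacity_nil; apply: (le_trans (IH _)).
rewrite size_sweep ?size_rev // addn0 le_eqVlt; apply/orP; left; apply/eqP.
by apply: eq_bernE => b _; rewrite take_size_cat ?drop_size_cat.
Qed.

(** The capacity starts at 1, does not decrease in expectation, and is at most 2 on survival and 0
    on extinction. *)
Lemma bernE_survival k : 1/2 <=
  bernE (2/3) (run_length k 1) (fun bits => (has id (run k [:: true] bits))%:R) :> R.
Proof.
have := bernE_run k [:: true]; have -> : S1 [:: true] = 1.
  by rewrite /= subr0 mulr1 addr0.
move=> H; suff : bernE (2/3) (run_length k 1) (fun bits => S1 (run k [:: true] bits))
   (* The summand [0 * 0] gives the bound the shape of [bernE_ZD]. *)
   <= bernE (2/3) (run_length k 1) (fun bits => 2 * (has id (run k [:: true] bits))%:R + 0 * 0) :> R.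
  by rewrite bernE_ZD; move: H; rewrite [size _]/=; lra.
apply: le_bernE => [|a _]; first by lra.
case hasE: (has id _) => /=; first by rewrite mulr1 mul0r addr0; apply: escape_sum_le2.
by rewrite escape_sum_nil ?hasE // !mulr0 addr0.
Qed.

End Survival.

(** * Oriented paths in the quadrant *)

Section OrientedPaths.
Local Open Scope nat_scope.

(* [(x, y, b)] is the edge leaving [(x, y)] eastwards if b, northwards otherwise. *)
Definition quadrant_edge := (nat * nat * bool)%type.
Implicit Types (c : quadrant_edge -> bool) (X Y : nat -> nat).

(* An up-right path is encoded by its abscissa: [(X t, t - X t)] is its position
   after t steps. *)
Definition monotone_path N X :=
  X 0 = 0 /\ forall t, t < N -> X t.+1 = X t \/ X t.+1 = (X t).+1.

Definition oriented_path c N X :=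
  X 0 = 0 /\ forall t, t < N ->
    X t.+1 = X t /\ c (X t, t - X t, false) \/ X t.+1 = (X t).+1 /\ c (X t, t - X t, true).

Lemma oriented_path_monotone c N X : oriented_path c N X -> monotone_path N X.
Proof. by move=> [X0 stepX]; split=> // t /stepX [] []; [left|right]. Qed.

Lemma monotone_path_le N X t : monotone_path N X -> t <= N -> X t <= t.
Proof.
move=> [X0 stepX]; elim: t => [|t IH] tN; first by rewrite X0.
by have := IH (ltnW tN); case: (stepX t tN) => ->; lia.
Qed.

Lemma monotone_path_homo N X t t' : monotone_path N X -> t <= t' -> t' <= N -> X t <= X t'.
Proof.
move=> [X0 stepX]; elim: t' => [|t' IH] tt' tN; first by have -> : t = 0 by lia.
case: (ltngtP t t'.+1) tt' => // [tt' _|-> //].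
by have := IH tt' (ltnW tN); case: (stepX t' tN) => ->; lia.
Qed.

(** Abscissas change by 0 or 1 per step, so two paths can exchange order only after standing at a
    common vertex; the maximum therefore always follows one of them. *)
Lemma oriented_path_max c N X Y : oriented_path c N X -> oriented_path c N Y ->
  oriented_path c N (fun t => maxn (X t) (Y t)).
Proof.
move=> [X0 stepX] [Y0 stepY]; split=> [|t tN]; first by rewrite X0 Y0.
case: (ltngtP (X t) (Y t)) => [lt|gt|eqXY].
- have -> : maxn (X t.+1) (Y t.+1) = Y t.+1.
    by case: (stepX t tN) (stepY t tN) => [] [] -> _ [] [] -> _; lia.
  exact: stepY.
- have -> : maxn (X t.+1) (Y t.+1) = X t.+1.
    by case: (stepX t tN) (stepY t tN) => [] [] -> _ [] [] -> _; lia.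
  exact: stepX.
- have := stepX t tN; have := stepY t tN; rewrite eqXY.
  case: (leqP (X t.+1) (Y t.+1)) => [le|lt] HY HX; first exact: HY.
  exact: HX.
Qed.

(** Discrete planarity: [Y] is read as a path going up and left from [(n, 0)], at
    [(n - Y t', t' - Y t')]. *)
Lemma monotone_path_crossing N n X Y :
  monotone_path N X -> monotone_path N Y -> n <= X N -> n <= Y N ->
  exists t t', [/\ t <= N, t' <= N, X t + Y t' = n & t - X t = t' - Y t'].
Proof.
move=> mX mY nX nY; have [X0 stepX] := mX; have [Y0 stepY] := mY.
(* At time t the first path is level with or above some point of the second in the same column. The
   earliest such time is where they meet. *)
pose Q t := [exists t' : 'I_N.+1, (X t + Y t' == n) && (t' - Y t' <= t - X t)].
pose Z t := (t <= N) && Q t.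
have exZ : exists t, Z t.
  pose reach t := (t <= N) && (n <= X t).
  have exr : exists t, reach t by exists N; rewrite /reach leqnn.
  case: (ex_minnP exr) => t /andP[tN nXt] mint; exists t.
  rewrite /Z tN; apply/existsP; exists ord0 => /=; rewrite Y0 addn0 subn0 andbT.
  case: t tN nXt mint => [|t] tN nXt mint; first by rewrite X0 in nXt *; lia.
  have lt : X t < n by rewrite ltnNge; apply/negP => nXt'; have := mint t; rewrite /reach nXt'; lia.
  by case: (stepX t tN) nXt => ->; lia.
case: (ex_minnP exZ) => t /andP[tN /existsP[t' /andP[/eqP XY hle]]] mint.
have t'N : t' <= N by rewrite -ltnS.
case: t tN XY hle mint => [|s] tN XY hle mint.
  by exists 0, t'; split=> //; rewrite X0 subnn in XY hle *; lia.
have notQ : ~~ Q s by apply/negP => Qs; have := mint s; rewrite /Z Qs; lia.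
have Xs := monotone_path_le mX (ltnW tN).
(* After a northward step the heights differ by less than one, so they agree. After an eastward
   step, [Y] has to be followed up its column. *)
case: (stepX s tN) => EX; rewrite EX in XY hle.
  have : ~~ (t' - Y t' <= s - X s).
    by apply: contra notQ => H; apply/existsP; exists t'; rewrite H XY eqxx.
  by move=> H; exists s.+1, t'; split=> //; rewrite EX //; lia.
(* The first time [Y] leaves the column or rises above [X]. If it rises, the vertex just before is
   common; if it moves left, [Q s] holds, against minimality. *)
pose past r := [&& t' <= r, r <= N & (Y t' < Y r) || (s - X s < r - Y r)].
have expast : exists r, past r by exists N; rewrite /past leqnn t'N; apply/orP; left; lia.
case: (ex_minnP expast) => r /and3P[t'r rN Hr] minr.
case: r t'r rN Hr minr => [|r] t'r rN Hr minr.
  by move: hle Hr t'r; case: (nat_of_ord t') XY; rewrite // ltnn /=; lia.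
have rt' : t' <= r.
  by rewrite -ltnS ltn_neqAle t'r andbT; apply/eqP => E; move: Hr; rewrite -E ltnn /=; lia.
have : ~~ past r by apply/negP => /minr; lia.
rewrite /past rt' (ltnW rN) /= negb_or -!leqNgt => /andP[Yr hr].
have Yr' : Y r = Y t' by apply/eqP; rewrite eqn_leq Yr; apply: (monotone_path_homo mY) => //; lia.
have Yrr := monotone_path_le mY (ltnW rN).
case: (stepY r rN) => EY.
  by exists s.+1, r; split=> //; rewrite ?EX ?Yr' //; move: Hr; rewrite EY Yr' ltnn /=; lia.
case/negP: notQ; apply/existsP; exists (Ordinal (n:=N.+1) (m:=r.+1) rN) => /=.
by rewrite EY Yr'; apply/andP; split; [apply/eqP|]; lia.
Qed.

(* The path stays, up to an error m, on or below the diagonal. *)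
Definition checkpoints K m X := forall k, k <= K -> m * k <= X (2 * m * k).

Lemma checkpoints_le K m X t : 0 < m -> monotone_path (2 * m * K) X -> checkpoints K m X ->
  t <= 2 * m * K -> t <= 2 * X t + 2 * m.
Proof.
move=> m0 mX chk tN; have := divn_eq t (2 * m); set k := t %/ (2 * m).
have : t %% (2 * m) < 2 * m by apply: ltn_pmod; lia.
set r := t %% (2 * m) => rm Et.
have kK : k <= K by rewrite -(leq_pmul2r (_ : 0 < 2 * m)); lia.
have := chk k kK; have := @monotone_path_homo _ _ (2 * m * k) t mX.
rewrite {1}Et; have -> : 2 * m * k <= k * (2 * m) + r by lia.
by move=> /(_ isT tN); lia.
Qed.

(** The common height h is at most [X t + 2 * m] and at most [Y t' + 2 * m], so
    [2 * h <= m * K + 4 * m], while [t + t' = m * K + 2 * h]. *)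
Lemma monotone_path_meeting K m X Y : 0 < m ->
  monotone_path (2 * m * K) X -> monotone_path (2 * m * K) Y ->
  checkpoints K m X -> checkpoints K m Y ->
  exists t t', [/\ t <= 2 * m * K, t' <= 2 * m * K, X t + Y t' = m * K,
    t - X t = t' - Y t' & t + t' <= 2 * m * K + 4 * m].
Proof.
move=> m0 mX mY cX cY.
have [t [t' [tN t'N XY hh]]] := monotone_path_crossing mX mY (cX K (leqnn K)) (cY K (leqnn K)).
exists t, t'; split=> //.
have := checkpoints_le m0 mX cX tN; have := checkpoints_le m0 mY cY t'N.
have := monotone_path_le mX tN; have := monotone_path_le mY t'N; lia.
Qed.

Lemma oriented_path_flip c N X : oriented_path (fun e => c (e.1.2, e.1.1, ~~ e.2)) N X ->
  oriented_path c N (fun t => t - X t).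
Proof.
move=> oX; have mX := oriented_path_monotone oX; have [X0 stepX] := oX.
split=> // t tN; have Xt := monotone_path_le mX (ltnW tN).
have -> : t - (t - X t) = X t by lia.
by case: (stepX t tN) => -[] -> /= H; [right|left]; split=> //; lia.
Qed.

Lemma oriented_path_sub c c' N X :
  (forall e, e.1.1 + e.1.2 < N -> c e -> c' e) -> oriented_path c N X -> oriented_path c' N X.
Proof.
move=> cc' oX; have mX := oriented_path_monotone oX; have [X0 stepX] := oX.
split=> // t tN; have Xt := monotone_path_le mX (ltnW tN).
by case: (stepX t tN) => -[-> H]; [left|right]; split=> //; apply: cc' => //=; lia.
Qed.

(** The order is the one in which [sweep] consumes bits: decreasing abscissa, the northward edge
    before the eastward one. *)
Fixpoint vertex_edges n k : seq quadrant_edge :=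
  if k is k'.+1 then [:: (k', n - k', false), (k', n - k', true) & vertex_edges n k']
  else [::].

Fixpoint triangle_edges n k : seq quadrant_edge :=
  if k is k'.+1 then vertex_edges n n.+1 ++ triangle_edges n.+1 k' else [::].

Lemma size_vertex_edges n k : size (vertex_edges n k) = 2 * k.
Proof. by elim: k => //= k ->; lia. Qed.

Lemma size_triangle_edges n k : size (triangle_edges n k) = run_length k n.+1.
Proof. by elim: k n => // k IH n; rewrite size_cat size_vertex_edges IH. Qed.

Lemma mem_vertex_edges n k e : (e \in vertex_edges n k) = (e.1.1 < k) && (e.1.2 == n - e.1.1).
Proof.
case: e => [[x y] b]; elim: k => //= k IH; rewrite !inE IH /=; rewrite !xpair_eqE.
by clear IH; rewrite ltnS; case: (ltngtP x k) => [||->]; case: b; rewrite /= ?andbF ?orbF ?andbT //= orbC.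
Qed.

Lemma vertex_edges_uniq n k : uniq (vertex_edges n k).
Proof.
by elim: k => //= k IH; rewrite !inE !mem_vertex_edges /= ltnn /= IH andbT orbF xpair_eqE andbF.
Qed.

Lemma mem_triangle_edges n k e :
  (e \in triangle_edges n k) = (n <= e.1.1 + e.1.2 < n + k).
Proof.
elim: k n => [|k IH] n; first by rewrite in_nil; lia.
by rewrite mem_cat IH mem_vertex_edges; clear IH; case: e => [[x y] b] /=; apply/idP/idP; lia.
Qed.

Lemma triangle_edges_uniq n k : uniq (triangle_edges n k).
Proof.
elim: k n => // k IH n; rewrite cat_uniq vertex_edges_uniq IH andbT.
apply/hasPn => e; rewrite mem_triangle_edges mem_vertex_edges; lia.
Qed.

Definition reachable c n x := exists2 X, oriented_path c n X & X n = x.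

Lemma reachable_step c n x (b : bool) : reachable c n x -> c (x, n - x, b) ->
  reachable c n.+1 (x + b).
Proof.
move=> [X [X0 stepX] Xn] cb; exists (fun t => if t <= n then X t else x + b); last by rewrite ltnn.
split=> // t; rewrite ltnS => tn; rewrite tn; case: (ltngtP t n) tn => // [lt _|-> _]; first exact: stepX.
by rewrite Xn; case: b cb => cb; [right|left]; rewrite ?addn0 ?addn1.
Qed.

(** Invariant of the sweep: [os] lists generation n downwards from abscissa [(size os).-1], and [ns]
    lists generation [n.+1] upwards from abscissa [size os]. *)
Lemma sweep_reachable c n os ns :
  (forall i, nth false os i -> reachable c n (size os - i.+1)) ->
  (forall i, nth false ns i -> reachable c n.+1 (size os + i)) -> ns != [::] ->
  forall i, nth false (sweep os ns (map c (vertex_edges n (size os)))) i -> reachable c n.+1 i.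
Proof.
elim: os ns => [|o os IH] [|b ns] //= Hos Hns _.
have Ho : o -> reachable c n (size os) by move=> oT; have := Hos 0 oT; rewrite subSS subn0.
apply: IH => // [i /= Hi|[|[|i]] /=].
- by have := Hos i.+1 Hi; rewrite subSS.
- by move=> /andP[/Ho H1 H2]; have := reachable_step H1 H2.
- case: b Hns => Hns /=; first by have := Hns 0 isT; rewrite addn0 addn1.
  by move=> /andP[/Ho H1 H2]; have := reachable_step H1 H2.
- by move=> Hi; have := Hns i.+1 Hi; rewrite addSn -addnS.
Qed.

Lemma run_reachable c k n s : size s = n.+1 ->
  (forall i, nth false s i -> reachable c n i) ->
  forall i, nth false (run k s (map c (triangle_edges n k))) i -> reachable c (n + k) i.
Proof.
elim: k n s => [|k IH] n s ss Hs i; first by rewrite addn0; apply: Hs.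
change (triangle_edges n k.+1) with (vertex_edges n n.+1 ++ triangle_edges n.+1 k).
change (run k.+1 s) with (fun bits =>
  run k (sweep (rev s) [:: false] (take (2 * size s) bits)) (drop (2 * size s) bits)).
cbv beta.
rewrite map_cat take_size_cat ?drop_size_cat ?size_map ?size_vertex_edges ?ss //.
rewrite -addSnnS; apply: IH => [|j].
  by rewrite size_sweep ?size_map ?size_vertex_edges ?size_rev ?ss //= addn0.
have := @sweep_reachable c n (rev s) [:: false]; rewrite size_rev ss => sweepP.
apply: sweepP => // [l|[|[]] //].
case: (ltnP l (size s)) => ls; last by rewrite nth_default ?size_rev.
by rewrite nth_rev // ss => /Hs.
Qed.

End OrientedPaths.

(** * Self-avoiding walks *)

Definition neighbors (v : vertex) : seq vertex :=
  [:: (v.1 + 1, v.2); (v.1 - 1, v.2); (v.1, v.2 + 1); (v.1, v.2 - 1)].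

Arguments neighbors : simpl never.

Lemma mem_neighbors u v : adjZ2 u v -> v \in neighbors u.
Proof. by case: u v => [a b] [x y]; rewrite /adjZ2 /neighbors /= !inE !xpair_eqE /=; lia. Qed.

Fixpoint saw_extensions k (visited : seq vertex) (cur : vertex) : seq (seq vertex) :=
  if k is k'.+1 then
    flatten [seq [seq v :: s | s <- saw_extensions k' (cur :: visited) v]
            | v <- neighbors cur & v \notin cur :: visited]
  else [:: [::]].

Lemma saw_extensionsS k visited cur : saw_extensions k.+1 visited cur =
  flatten [seq [seq v :: s | s <- saw_extensions k (cur :: visited) v]
          | v <- neighbors cur & v \notin cur :: visited].
Proof. by []. Qed.

Lemma mem_saw_extensions s visited cur : path adjZ2 cur s -> uniq (cur :: s) ->
  {in s, forall v, v \notin visited} -> s \in saw_extensions (size s) visited cur.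
Proof.
elim: s visited cur => [|v s IH] visited cur //= /andP[adj_v path_s].
rewrite inE negb_or => /andP[/andP[cur_v cur_s] /andP[v_s us]] sv.
apply/(@flatten_mapP _ _ _ [seq u <- neighbors cur | u \notin cur :: visited]); exists v.
  rewrite mem_filter mem_neighbors // andbT inE negb_or eq_sym cur_v /=.
  by apply: sv; rewrite mem_head.
apply: map_f; apply: IH => //=; first by rewrite v_s.
move=> x xs; rewrite inE negb_or sv ?inE ?xs ?orbT // andbT.
by apply: contraNneq cur_s => <-.
Qed.

Definition shift_vertex (a v : vertex) : vertex := (v.1 + a.1, v.2 + a.2).

Lemma shift_vertex_inj a : injective (shift_vertex a).
Proof. by move=> [x y] [x' y'] [] /addIr -> /addIr ->. Qed.

Lemma neighbors_shift a v : neighbors (shift_vertex a v) = map (shift_vertex a) (neighbors v).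
Proof. by rewrite /neighbors /shift_vertex /= !(addrAC _ a.1) !(addrAC _ a.2). Qed.

Lemma size_saw_extensions_shift a k visited v :
  size (saw_extensions k (map (shift_vertex a) visited) (shift_vertex a v))
  = size (saw_extensions k visited v).
Proof.
elim: k visited v => // k IH visited v; rewrite !saw_extensionsS !size_flatten /shape -!map_comp.
rewrite neighbors_shift filter_map -map_comp; congr sumn.
rewrite (@eq_filter _ _ (fun u => u \notin v :: visited)); last first.
  by move=> u /=; rewrite -map_cons mem_map //; apply: shift_vertex_inj.
by apply: eq_map => u /=; rewrite !size_map -map_cons IH.
Qed.

(* 30073, factored to avoid a large unary literal. *)
Definition saw_block_count := (17 * 29 * 61)%N.

(** Translation reduces the count to the four first steps from the origin, settled by evaluation.
    The value is a quarter of 120292, the number of self-avoiding walks of length 11. *)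
Lemma size_saw_extensions10 u v : adjZ2 u v ->
  size (saw_extensions 10 [:: u] v) = saw_block_count.
Proof.
have from0 : all (fun w => size (saw_extensions 10 [:: (0, 0)] w) == saw_block_count)
    (neighbors (0, 0)).
  by vm_cast_no_check (erefl true).
move=> /mem_neighbors; rewrite -{1}[u](_ : shift_vertex u (0, 0) = u); last first.
  by case: u => a b; rewrite /shift_vertex /= !add0r.
rewrite neighbors_shift => /mapP[w w0 ->].
rewrite -[X in [:: X]](_ : shift_vertex u (0, 0) = u); last first.
  by case: u {w0} => a b; rewrite /shift_vertex /= !add0r.
by rewrite (@size_saw_extensions_shift u 10 [:: (0, 0)]); apply/eqP; apply: (allP from0).
Qed.

Definition penultimate (x : vertex) (s : seq vertex) : vertex := nth x (x :: s) (size s).-1.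

(** Blocks of ten steps, each self-avoiding and avoiding only the vertex that precedes its start.
    This superset of the self-avoiding walks has an exact product count. *)
Fixpoint saw_list (x : vertex) k : seq (seq vertex) :=
  if k is k'.+1 then
    flatten [seq [seq s ++ e | e <- saw_extensions 10 [:: penultimate x s] (last x s)]
            | s <- saw_list x k']
  else [seq [:: v] | v <- neighbors x].

Lemma last_step (x : vertex) s : s != [::] -> path adjZ2 x s -> adjZ2 (penultimate x s) (last x s).
Proof.
case/lastP: s => // s y _; rewrite rcons_path last_rcons /penultimate size_rcons /=.
by rewrite -rcons_cons nth_rcons /= ltnS leqnn nth_last /= => /andP[].
Qed.

Lemma saw_list_complete x k s : path adjZ2 x s -> uniq (x :: s) -> size s = (10 * k).+1 ->
  s \in saw_list x k.
Proof.
elim: k s => [|k IH] s ps us ss.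
  case: s ps us ss => [|v [|? ?]] // /andP[adj _] _ _.
  exact: (map_f (fun v => [:: v]) (mem_neighbors adj)).
pose s1 := take (10 * k).+1 s; pose e := drop (10 * k).+1 s.
have sE : s = s1 ++ e by rewrite cat_take_drop.
have ss1 : size s1 = (10 * k).+1 by rewrite size_take ss; case: ltnP => //; lia.
have se : size e = 10%N by rewrite size_drop ss; lia.
rewrite sE cat_path in ps; have /andP[ps1 pe] := ps.
rewrite sE -cat_cons cat_uniq in us; have /and3P[us1 /hasPn dis ue] := us.
apply/(@flatten_mapP _ _ _ (saw_list x k)); exists s1; first exact: IH.
rewrite [X in X \in _]sE; apply: map_f.
rewrite -se; apply: mem_saw_extensions => //.
  by rewrite /= ue andbT; apply/negP => /dis; rewrite mem_last.
move=> v ve; rewrite inE; apply: contraTneq (dis v ve) => ->.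
by rewrite negbK mem_nth //= ss1; lia.
Qed.

Lemma saw_list_nonnil x k s : s \in saw_list x k -> s != [::].
Proof.
elim: k s => [|k IH] s; first by case/mapP => v _ ->.
by case/flatten_mapP => s1 /IH s1n /mapP[e _ ->]; case: s1 s1n.
Qed.

Lemma adj_neighbors u v : v \in neighbors u -> adjZ2 u v.
Proof. by case: u v => [a b] [x y]; rewrite /adjZ2 /neighbors /= !inE !xpair_eqE /=; lia. Qed.

Lemma saw_extensions_path k visited cur s :
  s \in saw_extensions k visited cur -> path adjZ2 cur s.
Proof.
elim: k visited cur s => [|k IH] visited cur s.
  by rewrite /= inE => /eqP ->.
rewrite saw_extensionsS.
move=> /(@flatten_mapP _ _ _ [seq u <- neighbors cur | u \notin cur :: visited])[v].
by rewrite mem_filter => /andP[_ /adj_neighbors adj] /mapP[s' /IH ps ->] /=; rewrite adj.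
Qed.

Lemma saw_list_path x k s : s \in saw_list x k -> path adjZ2 x s.
Proof.
elim: k s => [|k IH] s; first by case/mapP => v /adj_neighbors adj ->; rewrite /= adj.
move=> /(@flatten_mapP _ _ _ (saw_list x k))[s1 /IH p1 /mapP[e /saw_extensions_path pe ->]].
by rewrite cat_path p1.
Qed.

Lemma size_mem_saw_extensions k visited cur s :
  s \in saw_extensions k visited cur -> size s = k.
Proof.
elim: k visited cur s => [|k IH] visited cur s; first by rewrite /= inE => /eqP ->.
rewrite saw_extensionsS.
move=> /(@flatten_mapP _ _ _ [seq u <- neighbors cur | u \notin cur :: visited])[v _].
by move=> /mapP[s' /IH ss ->] /=; rewrite ss.
Qed.

Lemma size_mem_saw_list x k s : s \in saw_list x k -> size s = (10 * k).+1.
Proof.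
elim: k s => [|k IH] s; first by case/mapP => v _ ->.
move=> /(@flatten_mapP _ _ _ (saw_list x k))[s1 /IH s1s /mapP[e /size_mem_saw_extensions es ->]].
by rewrite size_cat s1s es; lia.
Qed.

Lemma size_saw_list x k : size (saw_list x k) = (4 * saw_block_count ^ k)%N.
Proof.
elim: k => [|k IH]; first by rewrite size_map.
rewrite [saw_list x k.+1]/= size_flatten /shape -map_comp.
rewrite (eq_in_map _ (fun=> saw_block_count) _).1.
  by rewrite sumnE big_map big_const_seq count_predT iter_addn_0 IH expnS; lia.
move=> s sk; rewrite /= size_map; apply: size_saw_extensions10; apply: last_step.
  exact: saw_list_nonnil sk.
exact: saw_list_path sk.
Qed.

Lemma edge_of_sharing u v u' v' : adjZ2 u v -> adjZ2 u' v' -> edge_of u v = edge_of u' v' ->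
  (u == u') || (u == v').
Proof.
case: u v u' v' => [a b] [c d] [a' b'] [c' d']; rewrite /adjZ2 /edge_of /= => H H' E.
rewrite !xpair_eqE; move: E.
have [bd|bd] := eqVneq b d; have [bd'|bd'] := eqVneq b' d' => // -[E1 E2]; lia.
Qed.

(** Using an edge again would mean returning to its first endpoint. Distinct edges make the weights
    along the walk independent. *)
Lemma path_edges_uniq x s : path adjZ2 x s -> uniq (x :: s) -> uniq (pairmap edge_of x s).
Proof.
elim: s x => //= y s IH x /andP[xy ps] /andP[xs us]; rewrite IH // andbT.
suff noshare z s' : path adjZ2 z s' -> x \notin z :: s' -> edge_of x y \notin pairmap edge_of z s'.
  exact: noshare.
elim: s' z => //= z' s' IHs z /andP[zz' ps']; rewrite !inE !negb_or => /and3P[xz xz' xs'].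
rewrite IHs ?inE ?negb_or ?xz' // andbT; apply/eqP => /(edge_of_sharing xy zz').
by rewrite (negbTE xz) (negbTE xz').
Qed.

Lemma path_displacement x s : path adjZ2 x s -> (`|(last x s).1 - x.1|%N <= size s)%N.
Proof.
elim: s x => [|y s IH] x /=; first by rewrite subrr.
by case/andP => xy /IH; move: xy; rewrite /adjZ2; lia.
Qed.

(** * Large deviations for the number of heavy edges *)

Section HeavyEdges.
Variable R : realFieldType.
Implicit Types (p u x : R).

Lemma bernE_expr_count p x n :
  bernE p n (fun a => x ^+ count negb a) = (p + (1 - p) * x) ^+ n.
Proof.
elim: n => //= n IH; rewrite exprS -IH [RHS]mulrDl; congr (_ + _).
rewrite -mulrA; congr (_ * _).
have := bernE_ZD p n x (fun a => x ^+ count negb a) 0 (fun=> 0); rewrite !mul0r addr0 => <-.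
by apply: eq_bernE => a _ /=; rewrite add1n exprS; ring.
Qed.

Lemma sqr_ge (a b c : R) : 0 <= b -> b <= a -> c <= b ^+ 2 -> c <= a ^+ 2.
Proof.
move=> b0 ba /le_trans; apply; apply: lerXn2r => //; rewrite nnegrE //.
exact: le_trans ba.
Qed.

(** Repeated squaring with bounds rounded down, then [100 = 64 + 32 + 4]. *)
Lemma expr100_ge u : 527/500 <= u -> 171 <= u ^+ 100.
Proof.
move=> u1; have U2 : 111/100 <= u ^+ 2 by apply: sqr_ge u1 _; lra.
have U4 : 123/100 <= u ^+ 4 by rewrite (exprM u 2 2); apply: sqr_ge U2 _; lra.
have U8 : 151/100 <= u ^+ 8 by rewrite (exprM u 4 2); apply: sqr_ge U4 _; lra.
have U16 : 57/25 <= u ^+ 16 by rewrite (exprM u 8 2); apply: sqr_ge U8 _; lra.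
have U32 : 519/100 <= u ^+ 32 by rewrite (exprM u 16 2); apply: sqr_ge U16 _; lra.
have U64 : 269/10 <= u ^+ 64 by rewrite (exprM u 32 2); apply: sqr_ge U32 _; lra.
rewrite (exprD u 64 36) (exprD u 32 4).
move: U64 U32 U4; set a := u ^+ 64; set b := u ^+ 32; set c := u ^+ 4 => Ha Hb Hc.
clear -Ha Hb Hc.
have bc : 638/100 <= b * c by nra.
by set e := b * c in bc *; nra.
Qed.

(* Exponential Markov inequality with the near-optimal tilt [x = u ^- 100]. *)
Lemma bernE_few_heavy p n : 0 <= p <= 1/3 ->
  bernE p n (fun a => (100 * count negb a < n)%N%:R) <= (89/250) ^+ n.
Proof.
move=> /andP[p0 p3]; pose u : R := 527/500.
have u1 : 1 <= u by rewrite /u; lra.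
have u0 : 0 < u by apply: lt_le_trans u1.
pose x := (u ^+ 100)^-1.
have u100 : 171 <= u ^+ 100 by apply: expr100_ge; rewrite /u.
have u100p : 0 < u ^+ 100 by apply: exprn_gt0.
have x0 : 0 < x by rewrite invr_gt0.
have x171 : x <= 1/171 by rewrite /x mul1r lef_pV2 // posrE; lra.
have bound : bernE p n (fun a => (100 * count negb a < n)%N%:R)
    <= bernE p n (fun a => u ^+ n * x ^+ count negb a + 0 * 0).
  apply: le_bernE => [|a _]; first by rewrite p0 (le_trans p3) //; lra.
  (* On the event, [u ^+ n * x ^+ count] is a nonnegative power of [u >= 1]. *)
  rewrite mul0r addr0; case: ltnP => [lt|_] /=; last by rewrite mulr_ge0 ?exprn_ge0 // ltW.
  rewrite /x exprVn -exprM -expfB //; exact: exprn_ege1.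
apply: (le_trans bound); rewrite (bernE_ZD p n _ _ 0 (fun=> 0)) !mul0r addr0 bernE_expr_count -exprMn.
clearbody x => {bound u100 u100p}.
apply: lerXn2r; rewrite ?nnegrE; last first.
- have px : p + (1 - p) * x <= 1/3 + 2/3 * x.
    have : p * (1 - x) <= 1/3 * (1 - x) by rewrite ler_wpM2r; lra.
    by rewrite mulrBr mulrBl; lra.
  (* The constant: [527/500 * (1/3 + 2/3 * 1/171)] is about 0.3555, just below 89/250. *)
  apply: (le_trans (ler_wpM2l (ltW u0) px)).
  have : u * x <= u * (1/171) by rewrite ler_wpM2l // ltW.
  by rewrite mulrDr mulrCA /u; lra.
- by lra.
- by apply: mulr_ge0 (ltW u0) _; apply: addr_ge0 p0 (mulr_ge0 _ (ltW x0)); lra.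
Qed.

End HeavyEdges.

Local Open Scope classical_set_scope.

(** * Events depending on finitely many edges *)

Section FiniteEvents.
Variables (R : realType) (d : measure_display) (Omega : measurableType d).
Variables (P : probability Omega R) (F : probability R R) (omega : edge -> Omega -> R).
Hypothesis omega_meas : forall e, measurable_fun setT (omega e).
Hypothesis omega_law :
  forall e (B : set R), measurable B -> P (omega e @^-1` B) = F B.
Hypothesis omega_indep : mutually_independent P omega.
Variable t : R.

Definition light om e : bool := omega e om <= t.

Let p := fine (F [set x | x <= t]).

Lemma measurable_le_level : measurable ([set x : R | x <= t]).
Proof. by rewrite -set_itvNyc; exact: measurable_itv. Qed.

Lemma light_probE : F [set x | x <= t] = p%:E.
Proof. by rewrite fineK // fin_num_measure //; exact: measurable_le_level. Qed.

Lemma light_prob01 : 0 <= p <= 1.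
Proof.
rewrite -!lee_fin -light_probE measure_ge0 probability_le1 //.
exact: measurable_le_level.
Qed.

Definition pattern_weight (bs : seq bool) : R := \prod_(b <- bs) (if b then p else 1 - p).

Lemma pattern_prob es bs : uniq es -> size es = size bs ->
  measurable [set om | map (light om) es = bs] /\
  P [set om | map (light om) es = bs] = (pattern_weight bs)%:E.
Proof.
move=> ues sbs.
pose B e := if nth false bs (index e es) then [set x : R | x <= t] else ~` [set x : R | x <= t].
have mB e : measurable (B e).
  by rewrite /B; case: ifP => _; [|apply: measurableC]; exact: measurable_le_level.
have -> : [set om | map (light om) es = bs] = \bigcap_(e in [set` es]) (omega e @^-1` B e).
  apply/seteqP; split=> om /=.
    move=> mapE e /= ees; rewrite /B -mapE (nth_map e) ?index_mem // nth_index //.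
    by case: ifP; rewrite /light //= => /negbT/negP.
  move=> H; apply: (@eq_from_nth _ false); rewrite ?size_map // => i ies.
  have e0 : edge by case: (es) ies.
  rewrite (nth_map e0) //; have := H (nth e0 es i) (mem_nth _ ies).
  by rewrite /B /= index_uniq //; case: (nth false bs i) => //= /negP/negbTE.
split.
  apply: fin_bigcap_measurable => // e _.
  by rewrite -[X in measurable X]setTI; apply: omega_meas.
rewrite omega_indep // /pattern_weight; rewrite (eq_bigr _ (fun e _ => omega_law e (mB e))).
have FB e : F (B e) = (if nth false bs (index e es) then p else 1 - p)%:E.
  rewrite /B; case: ifP => _; first exact: light_probE.
  by rewrite probability_setC ?light_probE //; exact: measurable_le_level.
under eq_bigr => e _ do rewrite FB.
rewrite prodEFin; congr (_%:E).
rewrite -[in RHS](_ : map (fun e => nth false bs (index e es)) es = bs) ?big_map //.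
apply: (@eq_from_nth _ false); rewrite ?size_map // => i ies.
have e0 : edge by case: (es) ies.
by rewrite (nth_map e0) // index_uniq.
Qed.

(** Generalized for induction: the bits of [es1] are frozen to [bs], and reading the next edge
    splits the event into two disjoint ones. *)
Lemma bits_prob_aux es1 bs es2 (f : seq bool -> bool) :
  uniq (es1 ++ es2) -> size es1 = size bs ->
  let E := [set om | map (light om) es1 = bs /\ f (map (light om) es2)] in
  measurable E /\
  P E = (pattern_weight bs * bernE p (size es2) (fun a => (f a)%:R))%:E.
Proof.
elim: es2 es1 bs f => [|e es2 IH] es1 bs f.
  rewrite cats0 => ues sbs /=; case fnil: (f [::]).
    rewrite mulr1 (_ : [set _ | _] = [set om | map (light om) es1 = bs]).
      exact: pattern_prob.
    by apply/seteqP; split=> om /= => [[]|].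
  rewrite mulr0 (_ : [set _ | _] = set0) ?measure0; first by split.
  by apply/seteqP; split=> om /= => -[].
move=> ues sbs /=.
have ues' : uniq (rcons es1 e ++ es2) by rewrite cat_rcons.
have sbs' b : size (rcons es1 e) = size (rcons bs b) by rewrite !size_rcons sbs.
have [mT PT] := IH _ _ (f \o cons true) ues' (sbs' true).
have [mF PF] := IH _ _ (f \o cons false) ues' (sbs' false).
have wt b : pattern_weight (rcons bs b) = pattern_weight bs * (if b then p else 1 - p).
  by rewrite /pattern_weight -cats1 big_cat big_seq1.
move: mT mF PT PF; set ET := [set _ | _]; set EF := [set _ | _] => mT mF PT PF.
have -> : [set om | map (light om) es1 = bs /\ f (light om e :: map (light om) es2)] = ET `|` EF.
  apply/seteqP; split=> om; rewrite /ET /EF /= !map_rcons.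
    by move=> [-> H]; case: (light om e) H => H; [left|right].
  by move=> [] [/rcons_inj [-> ->]].
split; first exact: measurableU.
have disj : ET `&` EF = set0.
  apply/seteqP; split=> om //; rewrite /ET /EF /= !map_rcons.
  by move=> [] [/rcons_inj [_ ->]] _ [/rcons_inj []].
have -> : P (ET `|` EF) = (P ET + P EF)%E by exact: measureU.
rewrite PT PF -EFinD !wt; congr (_%:E).
rewrite /=; set x := bernE _ _ _; set y := bernE _ _ _; set w := pattern_weight _.
rewrite -[X in w * (p * X + _)]/x -[X in w * (_ + (1 - p) * X)]/y; ring.
Qed.

Lemma bits_prob es (f : seq bool -> bool) : uniq es ->
  measurable [set om | f (map (light om) es)] /\
  P [set om | f (map (light om) es)] = (bernE p (size es) (fun a => (f a)%:R))%:E.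
Proof.
move=> ues; have := @bits_prob_aux [::] [::] es f ues erefl => /=.
rewrite /pattern_weight big_nil mul1r (_ : [set _ | _] = [set om | f (map (light om) es)]) //.
by apply/seteqP; split=> om /= => [[]|].
Qed.

Definition determined_by (T : eqType) (es : seq T) (A : (T -> bool) -> Prop) :=
  forall c c' : T -> bool, {in es, c =1 c'} -> A c -> A c'.

Definition increasing_event (T : eqType) (A : (T -> bool) -> Prop) :=
  forall c c' : T -> bool, (forall e, c e -> c' e) -> A c -> A c'.

(** For [bs] of the length of [es], edges outside [es] fall on the default of [nth] and count as
    closed. *)
Definition event_on (T : eqType) (es : seq T) (A : (T -> bool) -> Prop) (bs : seq bool) :=
  `[< A (fun e => nth false bs (index e es)) >].

Lemma event_prob (T : eqType) (psi : T -> edge) es (A : (T -> bool) -> Prop) :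
  uniq (map psi es) -> determined_by es A ->
  measurable [set om | A (light om \o psi)] /\
  P [set om | A (light om \o psi)] =
    (bernE p (size es) (fun a => (event_on es A a)%:R))%:E.
Proof.
move=> ues detA; have := @bits_prob _ (event_on es A) ues; rewrite size_map.
rewrite (_ : [set _ | _] = [set om | A (light om \o psi)]) //.
have cfgE om : {in es, (fun e => nth false (map (light om) (map psi es)) (index e es)) =1 light om \o psi}.
  by move=> e ees /=; rewrite -map_comp (nth_map e) ?index_mem // nth_index.
apply/seteqP; split=> om /= => [/asboolP|H]; first by apply: detA; apply: cfgE.
by apply/asboolP; apply: detA H => e ees; rewrite cfgE.
Qed.

Lemma event_on_increasing (T : eqType) (es : seq T) A :
  increasing_event A -> increasing (fun a => (event_on es A a)%:R : R).
Proof.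
move=> incA a b _ ab; rewrite ler_nat; case: (boolP (event_on es A a)) => // /asboolP Ha.
suff -> : event_on es A b by [].
by apply/asboolP; apply: incA Ha => e; apply: ab.
Qed.

Lemma harris_events (es1 es2 : seq edge) A1 A2 :
  determined_by es1 A1 -> determined_by es2 A2 ->
  increasing_event A1 -> increasing_event A2 ->
  (P [set om | A1 (light om)] * P [set om | A2 (light om)] <=
   P [set om | A1 (light om) /\ A2 (light om)])%E.
Proof.
move=> det1 det2 inc1 inc2; pose es := undup (es1 ++ es2).
have ues : uniq (map id es) by rewrite map_id undup_uniq.
have sub1 : {subset es1 <= es} by move=> e; rewrite mem_undup mem_cat => ->.
have sub2 : {subset es2 <= es} by move=> e; rewrite mem_undup mem_cat => ->; rewrite orbT.
have d1 : determined_by es A1 by move=> c c' cc'; apply: det1 => e /sub1; apply: cc'.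
have d2 : determined_by es A2 by move=> c c' cc'; apply: det2 => e /sub2; apply: cc'.
have d12 : determined_by es (fun c => A1 c /\ A2 c).
  by move=> c c' cc' [H1 H2]; split; [apply: d1 H1|apply: d2 H2].
have [_ ->] := event_prob ues d1; have [_ ->] := event_prob ues d2.
have [_ ->] := event_prob ues d12; rewrite -EFinM lee_fin.
have H := @harris R p (size es) _ _ light_prob01
  (@event_on_increasing _ es _ inc1) (@event_on_increasing _ es _ inc2).
apply: (le_trans H).
apply: le_bernE => [|a _]; first exact: light_prob01.
rewrite -natrM mulnb ler_nat; case: andP => // -[/asboolP H1 /asboolP H2].
by suff -> : event_on es (fun c => A1 c /\ A2 c) a by []; apply/asboolP.
Qed.

Lemma harris_iter (es : nat -> seq edge) A (a : R) k : 0 <= a ->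
  (forall i, (i < k)%N -> determined_by (es i) (A i)) ->
  (forall i, (i < k)%N -> increasing_event (A i)) ->
  (forall i, (i < k)%N -> (a%:E <= P [set om | A i (light om)])%E) ->
  ((a ^+ k)%:E <= P [set om | forall i, (i < k)%N -> A i (light om)])%E.
Proof.
move=> a0; elim: k => [|k IH] det inc ge.
  rewrite expr0 (_ : [set _ | _] = setT) ?probability_setT //.
  by apply/seteqP; split.
have {IH} := IH (fun i ik => det i (ltnW ik)) (fun i ik => inc i (ltnW ik))
  (fun i ik => ge i (ltnW ik)).
have -> : [set om | forall i, (i < k.+1)%N -> A i (light om)] =
    [set om | A k (light om) /\ forall i, (i < k)%N -> A i (light om)].
  apply/seteqP; split=> om /= H.
    by split=> [|i ik]; apply: H => //; apply: ltnW.
  by move=> i; rewrite ltnS leq_eqVlt => /orP[/eqP ->|]; [case: H|apply: H.2].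
move=> IH.
have := @harris_events (es k) (flatten [seq es i | i <- iota 0 k])
  (A k) (fun c => forall i, (i < k)%N -> A i c).
have det' : determined_by (flatten [seq es i | i <- iota 0 k])
    (fun c => forall i, (i < k)%N -> A i c).
  move=> c c' cc' H i ik; apply: det (H i ik) => [|e ei]; first exact: ltnW.
  by apply: cc'; apply/flatten_mapP; exists i; rewrite // mem_iota.
move=> /(_ (det k (ltnSn k)) det' (inc k (ltnSn k))) H.
apply: le_trans (H _).
  by rewrite exprS EFinM; apply: lee_pmul; rewrite ?lee_fin ?exprn_ge0 //; apply: ge.
move=> c c' cc' Hc i ik; apply: inc (Hc i ik) => //; exact: ltnW.
Qed.

End FiniteEvents.

(** * Crossing paths and passage times *)

(* Quadrant edges seen from the origin, or, mirrored, from [(n, 0)] with the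
   first coordinate reversed. *)
Definition embed_edge (n : nat) (mirror : bool) (q : quadrant_edge) : edge :=
  if mirror then ((n%:Z - (q.1.1 + q.2)%N%:Z, q.1.2%:Z), q.2)
  else ((q.1.1%:Z, q.1.2%:Z), q.2).

Definition flip_edge (q : quadrant_edge) : quadrant_edge := (q.1.2, q.1.1, ~~ q.2).

Lemma embed_edge_inj n b : injective (embed_edge n b).
Proof.
move=> [[x y] e] [[x' y'] e'] /=; rewrite /embed_edge /=.
case: b => -[] H H' He; subst e'; move: H H'; [move=> H [] ->|move=> -> [] ->] => //.
by congr (_, _, _); lia.
Qed.

Lemma flip_edgeK : involutive flip_edge.
Proof. by case=> -[x y] e; rewrite /flip_edge /= negbK. Qed.

(** The maximum of one path per checkpoint respects all checkpoints at once. *)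
Lemma checkpoints_merge c N K m :
  (forall k, (k <= K)%N -> exists X, oriented_path c N X /\ (m * k <= X (2 * m * k))%N) ->
  exists X, oriented_path c N X /\ checkpoints K m X.
Proof.
elim: K => [|K IH] H.
  have [X [oX HX]] := H 0%N (leqnn 0); exists X; split=> // k; rewrite leqn0 => /eqP ->; exact: HX.
have [X [oX HX]] := IH (fun k kK => H k (leqW kK)).
have [Y [oY HY]] := H K.+1 (leqnn _).
exists (fun t => maxn (X t) (Y t)); split; first exact: oriented_path_max.
move=> k; rewrite leq_eqVlt => /orP[/eqP ->|kK]; first by rewrite leq_max HY orbT.
by rewrite leq_max HX.
Qed.

Section GeometricPassage.
Variable R : realType.
Implicit Types (w : edge -> R) (t : R).

Definition light_step w t : rel vertex := fun u v => adjZ2 u v && (w (edge_of u v) <= t).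

Lemma path_weight_le w t x s : path (light_step w t) x s -> path_weight w x s <= (size s)%:R * t.
Proof.
rewrite /path_weight; elim: s x => [|y s IH] x /=; first by rewrite big_nil mul0r.
move=> /andP[/andP[_ le_t] /IH le_s]; rewrite big_cons -natr1 mulrDl mul1r addrC; exact: lerD.
Qed.

Lemma passage_time_le_light w t x s : 0 <= t -> path (light_step w t) x s ->
  passage_time w x (last x s) <= (size s)%:R * t.
Proof.
move=> t0 px; case: (shortenP px) => s' px' us' ss'.
have sa : sa_path x (last x s') s'.
  by rewrite /sa_path us' eqxx !andbT; apply: sub_path px' => u v /andP[].
have ws : path_weight w x s' <= (size s)%:R * t.
  apply: (le_trans (path_weight_le px')); rewrite ler_wpM2r // ler_nat.
  by apply: uniq_leq_size ss'; have /andP[] := us'.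
rewrite /passage_time; set S := [set _ | _].
(* Weights may be negative here; if the path weights are unbounded below, [inf] takes its default
   value 0. *)
case: (pselect (has_inf S)) => [hS|nS]; last by rewrite inf_out // mulr_ge0 ?ler0n.
by apply: le_trans ws; apply: ge_inf; [exact: hS.2|exists s'].
Qed.

Lemma walk_path (e : rel vertex) (f : nat -> vertex) k :
  (forall i, (i < k)%N -> e (f i) (f i.+1)) ->
  path e (f 0%N) (map f (iota 1 k)) /\ last (f 0%N) (map f (iota 1 k)) = f k.
Proof.
elim: k => [|k IH] H //.
have [H1 H2] := IH (fun i ik => H i (ltnW ik)).
by rewrite -(addn1 k) iotaD map_cat cat_path last_cat H1 H2 /= add1n addn1 H.
Qed.

Lemma passage_time_le_meeting w t K m X Y : 0 <= t -> (0 < m)%N ->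
  let n := (m * K)%N in let N := (2 * m * K)%N in
  oriented_path (fun q => w (embed_edge n false q) <= t) N X ->
  oriented_path (fun q => w (embed_edge n true q) <= t) N Y ->
  checkpoints K m X -> checkpoints K m Y ->
  passage_time w (0, 0) (n%:Z, 0) <= (2 * m * K + 4 * m)%N%:R * t.
Proof.
move=> t0 m0 n N oX oY cX cY.
have mX := oriented_path_monotone oX; have mY := oriented_path_monotone oY.
have [t1 [t2 [t1N t2N XY hh len]]] := monotone_path_meeting m0 mX mY cX cY.
pose v1 i : vertex := ((X i)%:Z, (i - X i)%N%:Z).
pose v2 i : vertex := (n%:Z - (Y i)%:Z, (i - Y i)%N%:Z).
(* The first path up to the meeting point, then the second one backwards. *)
pose f i := if (i <= t1)%N then v1 i else v2 (t2 - (i - t1))%N.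
have meet : v1 t1 = v2 t2 by rewrite /v1 /v2 hh; congr (_, _); lia.
have [X0 stepX] := oX; have [Y0 stepY] := oY.
have step1 i : (i < N)%N -> light_step w t (v1 i) (v1 i.+1).
  move=> iN; have Xi := monotone_path_le mX (ltnW iN); rewrite /light_step /adjZ2 /edge_of /v1 /=.
  case: (stepX i iN) => -[-> H].
    rewrite subSn // ifF; last by apply/eqP; lia.
    by apply/andP; split; [lia|]; rewrite (_ : Order.min _ _ = (i - X i)%N%:Z) //; lia.
  rewrite subSS eqxx; apply/andP; split; first by lia.
  by rewrite (_ : Order.min _ _ = (X i)%:Z) //; lia.
have step2 i : (i < N)%N -> light_step w t (v2 i.+1) (v2 i).
  move=> iN; have Yi := monotone_path_le mY (ltnW iN); rewrite /light_step /adjZ2 /edge_of /v2 /=.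
  case: (stepY i iN) => -[-> H].
    rewrite subSn // ifF; last by apply/eqP; lia.
    apply/andP; split; first by lia.
    by move: H; rewrite /embed_edge /= addn0 (_ : Order.min _ _ = (i - Y i)%N%:Z) //; lia.
  rewrite subSS eqxx; apply/andP; split; first by lia.
  by move: H; rewrite /embed_edge /= addn1 (_ : Order.min _ _ = n%:Z - (Y i).+1%:Z) //; lia.
have stepf i : (i < t1 + t2)%N -> light_step w t (f i) (f i.+1).
  move=> it; rewrite /f; case: (ltngtP i t1) => [lt|gt|E].
  - by apply: step1; apply: leq_trans t1N.
  - rewrite (_ : (t2 - (i - t1) = (t2 - (i.+1 - t1)).+1)%N); last by lia.
    by apply: step2; lia.
  - rewrite E meet (_ : v2 t2 = v2 (t2 - (t1.+1 - t1)).+1); first by apply: step2; lia.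
    by congr v2; lia.
have [pf lf] := walk_path stepf.
have f0 : f 0%N = (0, 0) by rewrite /f /= /v1 X0.
have fl : f (t1 + t2)%N = (n%:Z, 0).
  rewrite /f; case: leqP => H; last by rewrite addKn subnn /v2 Y0 subr0.
  have t20 : t2 = 0%N by lia.
  by rewrite t20 addn0 meet t20 /v2 Y0 subr0.
rewrite f0 in pf lf; have := passage_time_le_light t0 pf; rewrite lf fl size_map size_iota => H.
by apply: (le_trans H); rewrite ler_wpM2r // ler_nat.
Qed.

End GeometricPassage.

(** * Fast crossings with probability bounded below *)

Section FastCrossing.
Variables (R : realType) (d : measure_display) (Omega : measurableType d).
Variables (P : probability Omega R) (F : probability R R) (omega : edge -> Omega -> R).
Hypothesis omega_meas : forall e, measurable_fun setT (omega e).
Hypothesis omega_law :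
  forall e (B : set R), measurable B -> P (omega e @^-1` B) = F B.
Hypothesis omega_indep : mutually_independent P omega.
Variable t : R.
Hypothesis F_t : ((2/3)%:E <= F [set x : R | (x <= t)%R])%E.

Let p := fine (F [set x | x <= t]).

Let p_ge : 2/3 <= p.
Proof. by rewrite -lee_fin -light_probE. Qed.

Let p_le1 : p <= 1.
Proof. by have /andP[] := light_prob01 F t. Qed.

Let event_prob := event_prob omega_meas omega_law omega_indep.

Definition path_event N (good : (nat -> nat) -> Prop) (c : quadrant_edge -> bool) :=
  exists X, oriented_path c N X /\ good X.

Lemma path_event_determined N good : determined_by (triangle_edges 0 N) (path_event N good).
Proof.
move=> c c' cc' [X [oX gX]]; exists X; split=> //; apply: oriented_path_sub oX => e eN.
by rewrite cc' // mem_triangle_edges.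
Qed.

Lemma path_event_increasing N good : increasing_event (path_event N good).
Proof.
by move=> c c' cc' [X [oX gX]]; exists X; split=> //; apply: oriented_path_sub oX => e _; apply: cc'.
Qed.

Lemma path_event_prob psi N good : injective psi ->
  measurable [set om | path_event N good (light omega t om \o psi)] /\
  P [set om | path_event N good (light omega t om \o psi)] =
    (bernE p (run_length N 1)
       (fun a => (event_on (triangle_edges 0 N) (path_event N good) a)%:R))%:E.
Proof.
move=> inj; rewrite -size_triangle_edges; apply: event_prob.
  by rewrite map_inj_uniq ?triangle_edges_uniq.
exact: path_event_determined.
Qed.

(** Monotonicity carries the bound from 2/3 to [p >= 2/3], and an occupied site in the last
    generation provides an open path. *)
Lemma survival_prob psi N : injective psi ->
  ((1/2)%:E <= P [set om | path_event N (fun=> True) (light omega t om \o psi)])%E.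
Proof.
move=> inj; rewrite (path_event_prob _ _ inj).2 lee_fin.
apply: le_trans (bernE_survival R N) _.
have two3 : 0 <= 2/3 :> R by lra.
have inc := @event_on_increasing R _ (triangle_edges 0 N) _ (@path_event_increasing N (fun=> True)).
apply: le_trans (bernE_mono _ two3 p_ge p_le1 inc).
apply: le_bernE => [|a sa]; first by lra.
rewrite ler_nat; case hasE: (has id _) => //.
suff -> : event_on (triangle_edges 0 N) (path_event N (fun=> True)) a by [].
apply/asboolP; pose c e := nth false a (index e (triangle_edges 0 N)).
have ca : map c (triangle_edges 0 N) = a.
  rewrite -size_triangle_edges in sa.
  apply: (@eq_from_nth _ false); rewrite ?size_map // => i ies.
  have e0 : quadrant_edge by case: (triangle_edges 0 N) ies.
  by rewrite (nth_map e0) // /c index_uniq // triangle_edges_uniq.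
have [i _ Hi] := hasP hasE.
have /(nthP false)[j _ Hj] : true \in run N [:: true] a by move/hasP: hasE => [[] //].
have := @run_reachable c N 0 [:: true] erefl.
have reach0 i' : nth false [:: true] i' -> reachable c 0 i'.
  by case: i' => [|[]] // _; exists (fun=> 0%N).
move=> /(_ reach0 j); rewrite ca Hj => /(_ isT)[X oX _].
by exists X; split=> //; rewrite add0n in oX.
Qed.

(* Of a surviving path and its reflection in the diagonal, one is on or below
   the diagonal at time 2 m k. *)
Lemma checkpoint_prob psi K m k : injective psi -> (k <= K)%N ->
  ((1/4)%:E <= P [set om | path_event (2 * m * K) (fun X : nat -> nat => m * k <= X (2 * m * k)%N)%N
                             (light omega t om \o psi)])%E.
Proof.
move=> inj kK; set N := (2 * m * K)%N; set good := fun X : nat -> nat => _.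
have inj' : injective (psi \o flip_edge) by apply: inj_comp => //; apply: inv_inj flip_edgeK.
have [m1 E1] := path_event_prob N good inj; have [m2 E2] := path_event_prob N good inj'.
have [ms _] := path_event_prob N (fun=> True) inj.
have := survival_prob N inj.
set S := [set om | path_event N (fun=> True) _] in ms *.
set G1 := [set om | _] in m1 E1 *; set G2 := [set om | _] in m2 E2 *.
have sub : S `<=` G1 `|` G2.
  move=> om [X [oX _]]; case: (leqP (m * k)%N (X (2 * m * k)%N)) => H; [left|right].
    by exists X.
  have kN : (2 * m * k <= N)%N by rewrite leq_mul2l kK orbT.
  have Xk := monotone_path_le (oriented_path_monotone oX) kN.
  exists (fun i => i - X i)%N; split; last by rewrite /good /=; lia.
  apply: oriented_path_flip; apply: oriented_path_sub oX => -[[x y] b] _ /=.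
  by rewrite /flip_edge /= negbK.
have : (P S <= P G1 + P G2)%E.
  apply: le_trans (measureU2 P m1 m2); apply: le_measure => //; rewrite inE //; exact: measurableU.
rewrite E2 -E1 E1 => H1 H2; have := le_trans H2 H1.
by rewrite -EFinD !lee_fin; lra.
Qed.

(** The two sides share edges, so Harris' inequality takes the place of independence. The lower
    bound depends on K but not on m. *)
Lemma fast_crossing K m : 0 <= t -> (0 < m)%N ->
  exists2 G : set Omega, measurable G /\ (((1/4) ^+ (2 * K.+1))%:E <= P G)%E &
    forall om, G om ->
      passage_time (omega ^~ om) (0, 0) ((m * K)%N%:Z, 0) <= (2 * m * K + 4 * m)%N%:R * t.
Proof.
move=> t0 m0; pose N := (2 * m * K)%N; pose psi i := embed_edge (m * K) (odd i).
(* One index i encodes both data: its parity selects the side, [i./2] the checkpoint. *)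
pose good i := fun X : nat -> nat => (m * i./2 <= X (2 * m * i./2)%N)%N.
pose A i (c : edge -> bool) := path_event N (good i) (c \o psi i).
pose es i := map (psi i) (triangle_edges 0 N).
have detA i : determined_by (es i) (A i).
  by move=> c c' cc'; apply: path_event_determined => e eT; apply: cc'; apply: map_f.
have incA i : increasing_event (A i).
  by move=> c c' cc'; apply: path_event_increasing => e; apply: cc'.
have half i : (i < 2 * K.+1)%N -> (i./2 <= K)%N by lia.
have geA i : (i < 2 * K.+1)%N -> ((1/4)%:E <= P [set om | A i (light omega t om)])%E.
  by move=> /half iK; apply: checkpoint_prob iK; apply: embed_edge_inj.
exists [set om | forall i, (i < 2 * K.+1)%N -> A i (light omega t om)].
  split; last first.
    have quarter0 : 0 <= 1/4 :> R by lra.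
    exact: (harris_iter omega_meas omega_law omega_indep quarter0
      (fun i _ => detA i) (fun i _ => incA i) geA).
  pose all_es := flatten [seq es i | i <- iota 0 (2 * K.+1)].
  have uall : uniq (map id (undup all_es)) by rewrite map_id undup_uniq.
  suff detall : determined_by (undup all_es) (fun c => forall i, (i < 2 * K.+1)%N -> A i c).
    by have [] := event_prob t uall detall.
  move=> c c' cc' H i iK; apply: detA (H i iK) => e ei; apply: cc'.
  by rewrite mem_undup; apply/flatten_mapP; exists i; rewrite // mem_iota.
move=> om H.
have side b : exists X,
    oriented_path (light omega t om \o embed_edge (m * K) b) N X /\ checkpoints K m X.
  apply: checkpoints_merge => k kK.
  have := H (b + k.*2)%N; rewrite /A /psi /good halfD oddD odd_double doubleK andbF addbF add0n.
  rewrite (_ : b./2 = 0%N) ?add0n //; last by case: b.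
  by rewrite oddb; apply; case: b; lia.
have [X [oX cX]] := side false; have [Y [oY cY]] := side true.
exact: passage_time_le_meeting oX oY cX cY.
Qed.

End FastCrossing.

(** * Quantiles and measurability *)

(** The cdf at n tends to 1 > q, so the level set is nonempty and its [inf] is not a default
    value. *)
Lemma quantile_spec (R : realType) (F : probability R R) (q r : R) : q < 1 ->
  quantile F q < r -> exists t, [/\ 0 <= t, t < r & (q%:E <= Defs.cdf F t)%E].
Proof.
move=> q1 qr; set S := [set t : R | 0 <= t /\ (q%:E <= Defs.cdf F t)%E].
suff S0 : S !=set0 by have [t [t0 Ft] tr] := inf_lt S0 qr; exists t.
pose G (n : nat) := [set x : R | x <= n%:R].
have mG n : measurable (G n) by exact: measurable_le_level.
have GT : \bigcup_n G n = setT.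
  apply/seteqP; split=> // x _; exists (Num.bound `|x|) => //=.
  by rewrite /G /=; apply: (le_trans (ler_norm x)); apply/ltW/archi_boundP.
have ndG : nondecreasing_seq G.
  move=> n m nm; apply/subsetPset => x; rewrite /G /= => xn.
  by apply: le_trans xn _; rewrite ler_nat.
have cvF : F \o G @ \oo --> 1%E.
  by rewrite -(probability_setT F) -GT; apply: nondecreasing_cvg_mu => //; rewrite GT.
have := cvF _ (@open_ereal_gt' R 1%E q%:E _) => /=.
rewrite lte_fin => /(_ q1) [n _ /(_ n (leqnn n)) /= Hn].
by exists n%:R; split; rewrite ?ler0n //; apply: ltW.
Qed.

Lemma cdf_lt_quantile (R : realType) (F : probability R R) (q t : R) :
  F [set x : R | x < 0] = 0%E -> 0 < q -> t < quantile F q -> (Defs.cdf F t < q%:E)%E.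
Proof.
move=> F0 q0 tq; rewrite ltNge; apply/negP => Ft.
have [t0|t0] := leP 0 t.
  have : quantile F q <= t by apply: ge_inf; [exists 0 => x []|].
  by rewrite leNgt tq.
suff : (Defs.cdf F t <= 0)%E by move=> /(le_trans Ft); rewrite lee_fin leNgt q0.
rewrite -F0; apply: le_measure; rewrite ?inE.
- exact: measurable_le_level.
- by rewrite -set_itvNyo; exact: measurable_itv.
- by move=> x /= xt; apply: le_lt_trans t0.
Qed.

Lemma cvg_in_prob_lim_unlikely d (Omega : measurableType d) (R : realType)
    (P : probability Omega R) (Y : nat -> Omega -> R) (c eps a : R) :
  cvg_in_prob P Y c -> 0 < eps -> 0 < a ->
  exists N, forall n, (N <= n)%N -> (P [set om | (eps < `|Y n om - c|)%R] < a%:E)%E.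
Proof.
move=> cvgY eps0 a0; have := cvgY eps eps0.
move=> /(_ _ (@open_ereal_lt' R 0%E a%:E _)) /=; rewrite lte_fin => /(_ a0)[N _ H].
by exists N => n; apply: H.
Qed.

Section PassageTimeMeasurable.
Variables (R : realType) (d : measure_display) (Omega : measurableType d).
Variables (omega : edge -> Omega -> R).
Hypothesis omega_meas : forall e, measurable_fun setT (omega e).

Lemma measurable_path_weight x s :
  measurable_fun setT (fun om => path_weight (omega ^~ om) x s).
Proof. exact: measurable_sum. Qed.

Lemma measurable_bigcup_path (f : seq vertex -> set Omega) :
  (forall s, measurable (f s)) -> measurable (\bigcup_s f s).
Proof. by move=> mf; apply: countable_bigcupT_measurable => //; apply: countableP. Qed.

Lemma measurable_bigcap_path (f : seq vertex -> set Omega) :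
  (forall s, measurable (f s)) -> measurable (\bigcap_s f s).
Proof.
move=> mf; rewrite -[X in measurable X]setCK setC_bigcap; apply: measurableC.
by apply: measurable_bigcup_path => s; apply: measurableC.
Qed.

(** There are countably many paths; the delicate point is the default value of [inf] where path
    weights are unbounded below, hence the event [LB]. *)
Lemma measurable_passage_time x y :
  measurable_fun setT (fun om => passage_time (omega ^~ om) x y).
Proof.
have [[s0 sa0]|nosa] := pselect (exists s, sa_path x y s); last first.
  rewrite (_ : (fun _ => _) = fun=> 0); first exact: measurable_cst.
  apply/funext => om; rewrite /passage_time inf_out // => -[[r [s [sas _]]] _].
  by apply: nosa; exists s.
pose w s om := path_weight (omega ^~ om) x s.
have mw s : measurable_fun setT (w s) by exact: measurable_path_weight.
pose low (k : nat) s : set Omega := if sa_path x y s then [set om | - k%:R <= w s om] else setT.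
pose LB := \bigcup_k \bigcap_s low k s.
pose below c s : set Omega := if sa_path x y s then [set om | w s om < c] else set0.
have mlow k s : measurable (low k s).
  rewrite /low; case: ifP => // _.
  rewrite (_ : [set _ | _] = w s @^-1` [set` `[- k%:R, +oo[%R]); last first.
    by apply/seteqP; split=> om; rewrite /= in_itv /= andbT.
  by rewrite -[X in measurable X]setTI; apply: mw => //; exact: measurable_itv.
have mbelow c s : measurable (below c s).
  rewrite /below; case: ifP => // _.
  rewrite (_ : [set _ | _] = w s @^-1` [set` `]-oo, c[%R]); last first.
    by apply/seteqP; split=> om; rewrite /= in_itv /=.
  by rewrite -[X in measurable X]setTI; apply: mw => //; exact: measurable_itv.
have mLB : measurable LB.
  by apply: bigcupT_measurable => k; apply: measurable_bigcap_path.
pose S om := [set r : R | exists s, sa_path x y s /\ r = w s om].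
have LBP om : LB om <-> has_lbound (S om).
  split=> [[k _ H]|[b Hb]].
    by exists (- k%:R) => r [s [sas ->]]; have := H s I; rewrite /low sas.
  exists (Num.bound `|b|) => // s _; rewrite /low; case: ifP => // sas /=.
  apply: le_trans (Hb _ _); last by exists s.
  rewrite lerNl; apply: (le_trans (ler_norm (- b))); rewrite normrN.
  exact/ltW/archi_boundP.
apply: (measurability _ (@measurable_realfun.RGenInftyO.measurableE R)) => _ [_ [c ->] <-]; rewrite setTI.
(* On [LB] some path is lighter than c; off [LB] the passage time is 0. *)
rewrite (_ : _ @^-1` _ = (LB `&` \bigcup_s below c s) `|` (~` LB `&` [set om | 0 < c])).
  apply: measurableU; apply: measurableI => //; last first.
  - case: (ltP 0 c) => c0; [rewrite (_ : [set _ | _] = setT)|rewrite (_ : [set _ | _] = set0)] => //.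
      by apply/seteqP; split.
    by apply/seteqP; split=> om.
  - exact: measurableC.
  - exact: measurable_bigcup_path.
have S0 om : S om !=set0 by exists (w s0 om); exists s0.
apply/seteqP; split=> om; rewrite /= in_itv /=.
  move=> Tc; case: (pselect (LB om)) => lb; [left|right]; split=> //.
    have [r [s [sas ->]] rc] := inf_lt (S0 om) Tc.
    by exists s => //; rewrite /below sas.
  move: Tc; rewrite /passage_time -/(S om) inf_out // => -[_ /LBP]; exact: lb.
move=> [[/LBP lb [s _]]|[nlb c0]].
  rewrite /below; case: ifP => // sas /= wc; apply: le_lt_trans wc.
  by apply: ge_inf => //; exists s.
by rewrite /passage_time -/(S om) inf_out // => -[_ /LBP]; exact: nlb.
Qed.

End PassageTimeMeasurable.

(** * Paths with few heavy edges *)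

Lemma pairmap_take (x : vertex) s n : pairmap edge_of x (take n s) = take n (pairmap edge_of x s).
Proof. by elim: s x n => [|y s IH] x [|n] //=; rewrite IH. Qed.

Lemma straight_path n : exists s, sa_path (0, 0) (n%:Z, 0) s.
Proof.
pose f i : vertex := (i%:Z, 0).
have step i : (i < n)%N -> adjZ2 (f i) (f i.+1) by rewrite /adjZ2 /=; lia.
have [pf lf] := walk_path step; exists (map f (iota 1 n)).
rewrite /sa_path -[(0, 0)]/(f 0%N) pf lf eqxx andbT -map_cons -[0%N :: _]/(iota 0 n.+1).
by rewrite map_inj_uniq ?iota_uniq // => i j [].
Qed.

Section HeavyWeights.
Variables (R : realType) (d : measure_display) (Omega : measurableType d).
Variables (omega : edge -> Omega -> R) (t : R).

Definition has_light_path n k om :=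
  has (fun s => uniq ((0, 0) :: s) &&
         (100 * count negb (map (light omega t om) (pairmap edge_of (0, 0)%R s)) < n)%N)
      (saw_list (0, 0) k).

Lemma heavy_path_weight om s :
  (forall e, 0 <= omega e om) -> 0 <= t ->
  (count negb (map (light omega t om) s))%:R * t <= \sum_(e <- s) omega e om.
Proof.
move=> nn t0; elim: s => [|e s IH] /=; first by rewrite mul0r big_nil.
rewrite big_cons natrD mulrDl; apply: lerD => //.
by rewrite /light; case: (leP (omega e om) t) => [_|/ltW le] /=; rewrite ?mul0r ?mul1r.
Qed.

Lemma sum_weight_take om (s : seq edge) n : (forall e, 0 <= omega e om) ->
  \sum_(e <- take n s) omega e om <= \sum_(e <- s) omega e om.
Proof.
by move=> nn; rewrite -[X in _ <= \sum_(e <- X) _](cat_take_drop n) big_cat lerDl sumr_ge0.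
Qed.

(** A path to [(n, 0)] has at least n steps, and by nonnegativity its first n alone give the
    bound. *)
Lemma passage_time_ge_heavy om k : let n := (10 * k).+1 in
  (forall e, 0 <= omega e om) -> ~~ has_light_path n k om ->
  n%:R * (t / 100) <= passage_time (omega ^~ om) (0, 0) (n%:Z, 0).
Proof.
move=> n nn nolight; apply: lb_le_inf.
  by have [s sas] := straight_path n; exists (path_weight (omega ^~ om) (0, 0) s), s.
move=> _ [s [/and3P[ps us /eqP ls] ->]].
have [t0|t0] := leP 0 t; last first.
  apply: (@le_trans _ _ 0); last by rewrite sumr_ge0.
  by rewrite mulr_ge0_le0 // ltW // ltr_pdivrMr // mul0r.
have ns : (n <= size s)%N.
  by have := path_displacement ps; rewrite ls /=; lia.
have sn : size (take n s) = n by rewrite size_takel.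
have ptn : path adjZ2 (0, 0) (take n s).
  by move: ps; rewrite -[X in path _ _ X -> _](cat_take_drop n) cat_path => /andP[].
have utn : uniq ((0, 0) :: take n s).
  by move: us; rewrite -[X in uniq (_ :: X) -> _](cat_take_drop n) -cat_cons cat_uniq => /and3P[].
have mem := saw_list_complete ptn utn sn.
move/hasPn: nolight => /(_ _ mem); rewrite utn /= -leqNgt => many.
rewrite /path_weight; apply: le_trans (sum_weight_take (pairmap edge_of (0, 0) s) n nn).
rewrite -pairmap_take; apply: le_trans (heavy_path_weight _ nn t0).
rewrite mulrCA mulrC ler_wpM2r // ler_pdivrMr // -natrM ler_nat.
by rewrite mulnC.
Qed.

End HeavyWeights.

(** * Union bound over the listed walks *)

Section SlowPaths.
Variables (R : realType) (d : measure_display) (Omega : measurableType d).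
Variables (P : probability Omega R) (F : probability R R) (omega : edge -> Omega -> R).
Hypothesis F_neg : F [set x : R | x < 0] = 0%E.
Hypothesis omega_meas : forall e, measurable_fun setT (omega e).
Hypothesis omega_law :
  forall e (B : set R), measurable B -> P (omega e @^-1` B) = F B.
Hypothesis omega_indep : mutually_independent P omega.

Lemma union_bound_seq (T : eqType) (L : seq T) (f : T -> Omega -> bool) (b : R) :
  (forall x, x \in L -> measurable [set om | f x om] /\ (P [set om | f x om] <= b%:E)%E) ->
  measurable [set om | has (f ^~ om) L] /\
  (P [set om | has (f ^~ om) L] <= ((size L)%:R * b)%:E)%E.
Proof.
elim: L => [|x L IH] H.
  by rewrite (_ : [set _ | _] = set0) ?measure0 ?mul0r //; apply/seteqP; split.
have [mx Px] := H x (mem_head _ _).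
have [mL PL] := IH (fun y yL => H y (mem_behead (s := x :: L) yL)).
rewrite (_ : [set _ | _] = [set om | f x om] `|` [set om | has (f ^~ om) L]).
  split; first exact: measurableU.
  apply: (le_trans (measureU2 P mx mL)).
  by rewrite /= -natr1 mulrDl mul1r addrC EFinD; apply: leeD.
by apply/seteqP; split=> om /= /orP.
Qed.

Lemma nonneg_weights :
  exists2 NN : set Omega, measurable NN /\ P (~` NN) = 0%E &
    forall om, NN om -> forall e, 0 <= omega e om.
Proof.
pose neg (k : nat) : set Omega :=
  if (unpickle k : option edge) is Some e then omega e @^-1` [set x : R | x < 0] else set0.
have mneg0 : measurable [set x : R | x < 0] by rewrite -set_itvNyo; exact: measurable_itv.
have mneg k : measurable (neg k).
  rewrite /neg; case: (unpickle k) => [e|] //.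
  by rewrite -[X in measurable X]setTI; apply: omega_meas.
have mU : measurable (\bigcup_k neg k) by exact: bigcupT_measurable.
exists (~` \bigcup_k neg k).
  split; first exact: measurableC.
  rewrite setCK; apply: measure_negligible => //; apply: negligible_bigcup => k.
  apply/(negligibleP _ (mneg k)); rewrite /neg; case: (unpickle k) => [e|]; last exact: measure0.
  by exact: (etrans (omega_law e mneg0) F_neg).
move=> om H e; rewrite leNgt; apply/negP => lt; apply: H.
by exists (pickle e); [exact: I|rewrite /neg pickleK].
Qed.

Variable t : R.
Hypothesis F_t : (F [set x : R | (x <= t)%R] <= (1/3)%:E)%E.

Lemma light_path_prob k : let n := (10 * k).+1 in
  measurable [set om | has_light_path omega t n k om] /\
  (P [set om | has_light_path omega t n k om]
    <= ((4 * saw_block_count ^ k)%N%:R * (89/250) ^+ n)%:E)%E.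
Proof.
move=> n; rewrite -(size_saw_list (0, 0) k); apply: union_bound_seq => s sk.
case us : (uniq ((0, 0) :: s)); last first.
  (* Listed walks may revisit vertices; those contribute the empty event. *)
  rewrite (_ : [set _ | _] = set0); last by apply/seteqP; split.
  by rewrite measure0 lee_fin; split; [exact: measurable0|apply: exprn_ge0; lra].
have ps := saw_list_path sk.
have ue := path_edges_uniq ps us.
have [m E] := bits_prob omega_meas omega_law omega_indep t (fun a => 100 * count negb a < n)%N ue.
split; first exact: m.
rewrite [X in (X <= _)%E]E lee_fin size_pairmap.
have ss : size s = n by exact: size_mem_saw_list sk.
rewrite ss; apply: bernE_few_heavy; apply/andP; split.
  by have /andP[] := light_prob01 F t.
by rewrite -lee_fin -light_probE.
Qed.

End SlowPaths.

Lemma bernoulli_decay (R : realFieldType) k : (99/100) ^+ k * (1 + k%:R / 100) <= 1 :> R.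
Proof.
elim: k => [|k IH]; first by rewrite expr0 mul0r addr0 mulr1.
apply: le_trans IH; rewrite exprSr -mulrA ler_wpM2l ?exprn_ge0 //.
by rewrite -[k.+1%:R]natr1; have := ler0n R k; lra.
Qed.

Lemma saw_decay (R : realFieldType) (N : nat) :
  exists2 k, (N <= (10 * k).+1)%N &
    (4 * saw_block_count ^ k)%N%:R * (89/250) ^+ (10 * k).+1 <= 1/2 :> R.
Proof.
(* The shift by 300 makes [1 + k / 100 >= 4], so [y ^+ k <= 1/4], and the remaining factor is
   [4 * 89/250]. *)
exists (N + 300)%N; first by lia.
set k := (N + 300)%N.
pose y : R := saw_block_count%:R * (89/250) ^+ 10.
have y0 : 0 <= y by apply: mulr_ge0 (ler0n _ _) (exprn_ge0 _ _); lra.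
(* The growth factor per block of ten steps, about 0.983: this is where the walk count beats the
   tilt. *)
have y1 : y <= 99/100 by rewrite /y /saw_block_count !natrM; lra.
have k300 : 300 <= k%:R :> R by rewrite ler_nat leq_addl.
rewrite natrM natrX exprS exprM mulrACA -exprMn -/y.
have yk : y ^+ k <= (99/100) ^+ k by apply: lerXn2r; rewrite ?nnegrE // (le_trans y0).
have := bernoulli_decay R k; have : 0 <= (99/100) ^+ k :> R by exact: le_trans (exprn_ge0 k y0) yk.
move: yk; set z := (99/100) ^+ k => yk z0 decay.
have : z <= 1/4 by nra.
by move: yk; lra.
Qed.

Lemma measurable_deviation (R : realType) (d : measure_display) (Omega : measurableType d)
  (omega : edge -> Omega -> R) x y (a c eps : R) :
  (forall e, measurable_fun setT (omega e)) ->
  measurable [set om | eps < `|passage_time (omega ^~ om) x y / a - c|].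
Proof.
move=> mom; pose f om := `|passage_time (omega ^~ om) x y / a - c|.
have mf : measurable_fun setT f.
  apply: measurableT_comp => //; apply: measurable_funB => //; apply: measurable_funM => //.
  exact: measurable_passage_time.
rewrite (_ : [set _ | _] = f @^-1` `]eps, +oo[%classic).
  by rewrite -[X in measurable X]setTI; apply: mf => //; exact: measurable_itv.
by apply/seteqP; split=> om; rewrite /= in_itv /= andbT.
Qed.

Theorem mainTheorem1 (R : realType) (d : measure_display) (Omega : measurableType d)
  (P : probability Omega R) (F : probability R R) (omega : edge -> Omega -> R) (mu : R) :
  F [set x : R | x < 0] = 0%E ->
  (forall e, measurable_fun setT (omega e)) ->
  (forall e (B : set R), measurable B -> P (omega e @^-1` B) = F B) ->
  mutually_independent P omega ->
  cvg_in_prob P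
    (fun n om => passage_time (fun e => omega e om) (0, 0) (n%:Z, 0) / n%:R) mu ->
  quantile F (1/3) / 100 <= mu /\ mu <= 2 * quantile F (2/3).
Proof.
move=> F_neg mom law indep cvgT; split; rewrite leNgt; apply/negP => lt.
(* A level strictly between [100 * mu] and the quantile; then [t / 100 = mu + 2 * eps] below. *)
- pose t := (100 * mu + quantile F (1/3)) / 2.
  have tq : t < quantile F (1/3) by rewrite /t; lra.
  have tmu : mu < t / 100 by rewrite /t; lra.
  pose eps := (t / 100 - mu) / 2.
  have eps0 : 0 < eps by rewrite /eps; lra.
  have half0 : 0 < 1/2 :> R by lra.
  have third0 : 0 < 1/3 :> R by lra.
  have Ft := ltW (cdf_lt_quantile F_neg third0 tq).
  have [N unlikely] := cvg_in_prob_lim_unlikely cvgT eps0 half0.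
  have [k Nk small] := saw_decay R N.
  have [NN [mNN PNN] nonneg] := nonneg_weights F_neg mom law.
  have [mL PL] := light_path_prob mom law indep Ft k.
  have := unlikely _ Nk; apply/negP; rewrite -leNgt.
  set n := (10 * k).+1; set L := [set om | _] in mL PL.
  have n0 : 0 < n%:R :> R by rewrite ltr0n.
  apply: (@le_trans _ _ (P (~` (~` NN `|` L)))).
    have mU : measurable (~` NN `|` L) by apply: measurableU => //; exact: measurableC.
    have -> : P (~` (~` NN `|` L)) = (1 - P (~` NN `|` L))%E by exact: probability_setC.
    have PU : (P (~` NN `|` L) <= (1/2)%:E)%E.
      have sub : (P (~` NN `|` L) <= P (~` NN) + P L)%E.
        by apply: measureU2 => //; exact: measurableC.
      by apply: (le_trans sub); rewrite PNN add0e; apply: (le_trans PL); rewrite lee_fin.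
    rewrite leeBrDr; last by rewrite fin_num_measure.
    by apply: (le_trans (leeD2l _ PU)); rewrite -EFinD lee_fin; lra.
  apply: le_measure; rewrite ?inE.
  + by apply: measurableC; apply: measurableU => //; exact: measurableC.
  + exact: measurable_deviation.
  + rewrite setCU setCK => om [/nonneg nn /= /negP nL].
    have := passage_time_ge_heavy nn nL; rewrite -/n => T_ge.
    have : t / 100 <= passage_time (omega ^~ om) (0, 0) (n%:Z, 0) / n%:R.
      by rewrite ler_pdivlMr // mulrC.
    by move=> H; rewrite ger0_norm; move: tmu; rewrite /eps; lra.
- pose r := (quantile F (2/3) + mu / 2) / 2.
  have two1 : 2/3 < 1 :> R by lra.
  have qr : quantile F (2/3) < r by rewrite /r; lra.
  have [t [t0 tr Ft]] := quantile_spec two1 qr.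
  have tmu : 2 * t < mu by rewrite /r in tr; lra.
  pose gap := mu - 2 * t.
  have gap0 : 0 < gap by rewrite /gap; lra.
  (* Large enough that the excess [4 * m * t] over [n = m * K] steps is at most [gap / 3] per
     step. *)
  pose K := (Num.bound (12 * t / gap)).+1.
  have K0 : 0 < K%:R :> R by rewrite ltr0n.
  have Kt : 12 * t <= gap * K%:R.
    have bd : 12 * t / gap < (Num.bound (12 * t / gap))%:R.
      by apply: archi_boundP; rewrite divr_ge0 ?mulr_ge0 // ltW.
    have : 12 * t / gap < K%:R by apply: lt_le_trans bd _; rewrite ler_nat.
    by rewrite ltr_pdivrMr // [_ * gap]mulrC => /ltW.
  have eps0 : 0 < gap / 3 by lra.
  have a0 : 0 < (1/4) ^+ (2 * K.+1) :> R by apply: exprn_gt0; lra.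
  have [N unlikely] := cvg_in_prob_lim_unlikely cvgT eps0 a0.
  (* K is fixed before N, so taking [m = N.+1] makes the distance large while the probability bound
     stays the same. *)
  have [G [mG PG] fast] := @fast_crossing _ _ _ _ _ _ mom law indep t Ft K N.+1 t0 isT.
  have NK : (N <= N.+1 * K)%N by apply: leq_trans (leqnSn N) (leq_pmulr _ _).
  have := unlikely _ NK; apply/negP; rewrite -leNgt.
  apply: (le_trans PG); apply: le_measure; rewrite ?inE //.
    exact: measurable_deviation.
  move=> om /fast T_le /=; set n := (N.+1 * K)%N; rewrite -/n in T_le.
  have n0 : 0 < n%:R :> R by rewrite ltr0n /n muln_gt0.
  have T_le' : passage_time (omega ^~ om) (0, 0) (n%:Z, 0) / n%:R <= 2 * t + gap / 3.
    rewrite ler_pdivrMr //; apply: (le_trans T_le).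
    rewrite /n !natrD !natrM.
    have : 0 < N.+1%:R :> R by rewrite ltr0n.
    by move: Kt K0; set x := N.+1%:R; set y := K%:R => *; nra.
  (* The ratio lies at least [2/3 * gap] below [mu]. *)
  rewrite ltr0_norm; move: T_le'; rewrite /gap; lra.
Qed.
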